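(* Let $1\le p<\infty$, with $1\le s<p$ if $1<p<\infty$ and $s=1$ if $p=1$. Let $w_1,w_2$ be weights on $\mathbb{R}^n$ with $(w_1^s,w_2^s)\in A_{p/s}$ and $w_2^s\in A_{p/s}$. Let $S$ be a sublinear operator satisfying, with a constant $C$ independent of $f$, $a$, $r$, $$\sup_{x\in B(a,r)}\left|S\left(f\cdot\mathcal{X}_{B(a,2r)^c}\right)(x)\right|\le C\sum_{k=1}^\infty(2^{k+1}r)^{-\frac ns}\left(\int_{B(a,2^{k+1}r)}|f(y)|^s\,dy\right)^{1/s},\quad (a,r)\in\mathbb{R}^n\times\mathbb{R}^+ .$$ Suppose that two positive functions $\psi_1,\psi_2$ on $\mathbb{R}^n\times\mathbb{R}^+$ satisfy $$\sup_{(a,r)\in\mathbb{R}^n\times\mathbb{R}^+}\frac1{\psi_2(a,r)}\int_r^\infty\frac{\inf_{t\le l<\infty}\psi_1(a,l)\,w_1(B(a,l))^{1/p}}{w_2(B(a,t))^{1/p}}\frac{dt}t<\infty .$$ Then: (i) if $1<p<\infty$ and $S$ is bounded from $L^{p,w_1}$ to $L^{p,w_2}$, then $S$ is bounded from $\mathcal{M}^{p,w_1}_{\psi_1}$ to $\mathcal{M}^{p,w_2}_{\psi_2}$; (ii) if $p=1$ and $S$ is bounded from $L^{1,w_1}$ to $WL^{1,w_2}$, then $S$ is bounded from $\mathcal{M}^{1,w_1}_{\psi_1}$ to $W\mathcal{M}^{1,w_2}_{\psi_2}$.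
   Context: Notation: $\mathbb{R}^+=(0,\infty)$; $B(a,r)$ is the open ball in $\mathbb{R}^n$; $\mathcal{X}_E$ is the indicator function of $E$ and $E^c$ its complement. A weight is a nonnegative locally integrable function on $\mathbb{R}^n$ with values in $(0,\infty)$ a.e.; $w(E)=\int_E w(x)\,dx$. Weight classes: for $1<p<\infty$, a pair $(w_1,w_2)$ belongs to $A_p$ if there is $C>0$ with $\left(\frac1{|B|}\int_B w_2\right)\left(\frac1{|B|}\int_B w_1^{-1/(p-1)}\right)^{p-1}\le C$ for all balls $B$; $(w_1,w_2)\in A_1$ if $\left(\frac1{|B|}\int_B w_2\right)\|w_1^{-1}\|_{L^\infty(B)}\le C$ for all balls $B$. A single weight $w$ is in $A_p$ if $(w,w)\in A_p$. Spaces: for $1\le p<\infty$ and measurable $E\subseteq\mathbb{R}^n$, $\|f\|_{L^{p,w}(E)}=\left(\int_E|f|^pw\right)^{1/p}$ and $\|f\|_{WL^{p,w}(E)}=\sup_{\gamma>0}\gamma\,w(\{x\in E:|f(x)|>\gamma\})^{1/p}$; $L^{p,w}$, $WL^{p,w}$ denote the case $E=\mathbb{R}^n$. For positive $\psi$ on $\mathbb{R}^n\times\mathbb{R}^+$, $\mathcal{M}^{p,w}_\psi$ and $W\mathcal{M}^{p,w}_\psi$ consist of the measurable $f$ for which respectively $\|f\|_{\mathcal{M}^{p,w}_\psi}=\sup_{a,r}\frac{1}{\psi(a,r)}w(B(a,r))^{-1/p}\|f\|_{L^{p,w}(B(a,r))}$ and $\|f\|_{W\mathcal{M}^{p,w}_\psi}=\sup_{a,r}\frac{1}{\psi(a,r)}w(B(a,r))^{-1/p}\|f\|_{WL^{p,w}(B(a,r))}$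 is finite. An operator $N$ is bounded from $X$ to $Y$ if there is $C>0$ with $\|Nf\|_Y\le C\|f\|_X$ for all $f\in X$. *)

(* Defs.v *)
From HB Require Import structures.
From mathcomp Require Import all_boot all_order all_algebra.
From mathcomp Require Import all_classical all_reals all_analysis.
From mathcomp Require Import measurable_realfun.

Set Implicit Arguments.
Unset Strict Implicit.
Unset Printing Implicit Defensive.

Import Order.TTheory GRing.Theory Num.Theory.
Import numFieldNormedType.Exports.

Local Open Scope classical_set_scope.
Local Open Scope ring_scope.
Local Open Scope ereal_scope.

(** Lebesgue measure on [R^(n.+1)]: the Caratheodory measure of the outer measure
    obtained from countable covers by half-open boxes.  Its measurable sets are
    all the Lebesgue measurable sets, not only the Borel sets. *)
Section lebesgue_outer_measure.
Context {R : realType} {n : nat}.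
Implicit Types (I : 'rV[R]_n.+1 * 'rV[R]_n.+1) (A : set 'rV[R]_n.+1).

Definition box I : set 'rV[R]_n.+1 :=
  [set x | forall i, (I.1 ord0 i < x ord0 i <= I.2 ord0 i)%R].

Definition box_volume I : \bar R :=
  (\prod_(i < n.+1) Num.max 0 (I.2 ord0 i - I.1 ord0 i))%R%:E.

Definition lebesgue_outer A : \bar R :=
  ereal_inf [set \sum_(k <oo) box_volume (u k) |
    u in [set u : nat -> 'rV[R]_n.+1 * 'rV[R]_n.+1 | A `<=` \bigcup_k box (u k)]].

Lemma box_volume_ge0 I : 0 <= box_volume I.
Proof. by rewrite lee_fin prodr_ge0// => i _; rewrite le_max lexx. Qed.

Lemma lebesgue_outer_ge0 A : 0 <= lebesgue_outer A.
Proof.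
apply: le_ereal_inf_tmp => _ [u _ <-].
by apply: nneseries_ge0 => k _ _; exact: box_volume_ge0.
Qed.

Lemma lebesgue_outer0 : lebesgue_outer set0 = 0.
Proof.
apply/eqP; rewrite eq_le lebesgue_outer_ge0 andbT.
apply: ereal_inf_lbound; exists (fun=> (0, 0)%R) => //.
rewrite eseries0// => k _ _; rewrite /box_volume /= big_ord_recl.
by rewrite subrr maxxx mul0r.
Qed.

Lemma le_lebesgue_outer :
  {homo lebesgue_outer : A B / A `<=` B >-> A <= B}.
Proof.
move=> A B AB; apply/ereal_inf_le_tmp => _ [u Bu <-].
by exists u => //; exact: subset_trans AB Bu.
Qed.

Lemma lebesgue_outer_sigma_subadditive : sigma_subadditive lebesgue_outer.
Proof.
move=> A; have [[i ioo]|] := pselect (exists i, lebesgue_outer (A i) = +oo).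
  rewrite (eseries_pinfty _ _ ioo) ?leey// => k _.
  by rewrite -ltNye (lt_le_trans _ (lebesgue_outer_ge0 _)).
rewrite -forallNE => Aoo.
apply/lee_addgt0Pr => _/posnumP[e].
rewrite (le_trans _ (epsilon_trick _ _ _))//; last first.
  by move=> k; exact: lebesgue_outer_ge0.
pose P k (u : nat -> 'rV[R]_n.+1 * 'rV[R]_n.+1) :=
  A k `<=` \bigcup_j box (u j) /\
  \sum_(j <oo) box_volume (u j) <=
    lebesgue_outer (A k) + (e%:num / (2 ^ k.+1)%:R)%:E.
have [G PG] : {G & forall k, P k (G k)}.
  apply: (@choice _ _ P) => k; rewrite /P.
  have e0 : (0 < e%:num / (2 ^ k.+1)%:R)%R by [].
  have Afin : lebesgue_outer (A k) \is a fin_num.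
    rewrite ge0_fin_numE ?lebesgue_outer_ge0// ltey.
    by apply/eqP; exact: Aoo.
  have [_ [u Au <-] /ltW us] := lb_ereal_inf_adherent e0 Afin.
  by exists u; split.
apply: (@le_trans _ _ (\esum_(i in setT) (box_volume \o uncurry G) i)).
  apply: ereal_inf_lbound => /=.
  have /card_esym/ppcard_eqP[f] := card_nat2.
  exists (uncurry G \o f).
    move=> t [i _ /(PG i).1[j _ tij]].
    by exists (f^-1%FUN (i, j)) => //=; rewrite invK ?inE.
  rewrite -(esum_pred_image (box_volume \o uncurry G) _ xpredT)
    ?[fun=> _]set_true//; first by rewrite image_eq.
  by move=> k _; exact: box_volume_ge0.
rewrite (_ : esum _ _ = \sum_(i <oo) \sum_(j <oo) box_volume (G i j)).
  apply: lee_nneseries => k _.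
    by move=> _; apply: nneseries_ge0 => j _ _; exact: box_volume_ge0.
  exact: (PG k).2.
pose J : nat -> set (nat * nat) := fun i => [set (i, j) | j in setT].
rewrite (_ : setT = \bigcup_k J k); last first.
  by rewrite predeqE => -[a b]; split => // _; exists a => //; exists b.
rewrite esum_bigcupT /=; last 2 first.
  - apply/trivIsetP => i j _ _ ij.
    rewrite predeqE => -[p q] /=; split => //= -[] [_] _ [<-{p} _].
    by move=> [q' _] [] /esym/eqP; rewrite (negbTE ij).
  - by move=> x; exact: box_volume_ge0.
rewrite -(image_id [set: nat]) -fun_true esum_pred_image//; last first.
  by move=> k _; apply: esum_ge0 => x _; exact: box_volume_ge0.
apply: eq_eseriesr => /= j _.
rewrite -(esum_pred_image (box_volume \o uncurry G) (pair j) predT)//=.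
- by congr esum; rewrite predeqE => -[a b]; split; move=> [i _ <-]; exists i.
- by move=> k _; exact: box_volume_ge0.
- by move=> ? ? _ _; exact: (@can_inj _ _ _ snd).
Qed.

HB.instance Definition _ := isOuterMeasure.Build R 'rV[R]_n.+1 lebesgue_outer
  lebesgue_outer0 lebesgue_outer_ge0 le_lebesgue_outer
  lebesgue_outer_sigma_subadditive.

End lebesgue_outer_measure.

Definition rvec (R : realType) (n : nat) : Type := 'rV[R]_n.+1.

HB.instance Definition _ (R : realType) (n : nat) :=
  NormedModule.on (rvec R n).
HB.instance Definition _ (R : realType) (n : nat) :=
  Measurable.copy (rvec R n) (caratheodory_type (@lebesgue_outer R n)).

Definition lebesgue {R : realType} {n : nat} : set (rvec R n) -> \bar R :=
  lebesgue_outer.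

HB.instance Definition _ (R : realType) (n : nat) :=
  isMeasure.Build _ (rvec R n) R (@lebesgue R n)
    (@caratheodory_measure0 R _ (@lebesgue_outer R n))
    (@caratheodory_measure_ge0 R _ (@lebesgue_outer R n))
    (@caratheodory_measure_sigma_additive R _ (@lebesgue_outer R n)).

Section weighted_morrey.
Context {R : realType} {n : nat}.
Local Notation E := (rvec R n).
Local Notation mu := (@lebesgue R n).
Implicit Types (a x : E) (r p : R) (w : E -> R) (A : set E) (f : E -> \bar R).

(** The norm of ['rV[R]_n] provided by the library is the sup norm. *)
Definition euclidean_norm x : R := Num.sqrt (\sum_i (x ord0 i) ^+ 2)%R.

Definition eball a r : set E := [set x | (euclidean_norm (x - a) < r)%R].

Definition weight w : Prop :=
  [/\ measurable_fun [set: E] w,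
      (forall x, (0 <= w x)%R),
      {ae mu, forall x, (0 < w x)%R} &
      forall K : set E, compact K -> \int[mu]_(x in K) (w x)%:E < +oo].

Definition wmeasure w A : \bar R := \int[mu]_(x in A) (w x)%:E.

Definition average A f : \bar R := (mu A)^-1 * \int[mu]_(x in A) f x.

(** [1 / w] is real-valued with value [0] where [w] vanishes, which is harmless
    since weights vanish only on null sets. *)
Definition Muckenhoupt p w1 w2 : Prop :=
  exists2 C : R, (0 < C)%R & forall a r, (0 < r)%R ->
    let B := eball a r in
    average B (EFin \o w2) *
      (if p == 1%R
       then 'N[mu]_+oo[(fun x => ((w1 x)^-1 * \1_B x)%:E)]
       else average B (fun x => (w1 x `^ (- (p - 1)^-1))%:E) `^ (p - 1))
    <= C%:E.

Definition wLnorm p w A f : \bar R :=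
  (\int[mu]_(x in A) (`|f x| `^ p * (w x)%:E)) `^ p^-1.

Definition wWLnorm p w A f : \bar R :=
  ereal_sup [set g%:E * wmeasure w (A `&` [set x | g%:E < `|f x|]) `^ p^-1 |
    g in [set g : R | (0 < g)%R]].

Definition morrey_norm p w (psi : E -> R -> R) f : \bar R :=
  ereal_sup [set (psi a r)^-1%:E * wmeasure w (eball a r) `^ (- p^-1) *
      wLnorm p w (eball a r) f | a in [set: E] & r in [set r | (0 < r)%R]].

Definition weak_morrey_norm p w (psi : E -> R -> R) f : \bar R :=
  ereal_sup [set (psi a r)^-1%:E * wmeasure w (eball a r) `^ (- p^-1) *
      wWLnorm p w (eball a r) f | a in [set: E] & r in [set r | (0 < r)%R]].

Implicit Types (D : set (E -> R)) (S : (E -> R) -> E -> \bar R).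

Definition finite_norm_space (N : (E -> \bar R) -> \bar R) : set (E -> R) :=
  [set f : E -> R | measurable_fun [set: E] f /\ N (EFin \o f) < +oo].

(** Operators such as singular integrals are not defined on all measurable
    functions, so the domain is explicit; stability under truncation is what
    [size_condition] presupposes.  All measurable functions form such a [D]. *)
Definition operator_domain D : Prop :=
  [/\ D `<=` [set f : E -> R | measurable_fun [set: E] f],
      D (cst 0%R),
      (forall f g : E -> R, D f -> D g -> D (f \+ g)%R),
      (forall c (f : E -> R), D f -> D (fun x => c * f x)%R) &
      forall (f : E -> R) a r, (0 < r)%R -> D f ->
        D (fun x => f x * \1_(~` eball a r) x)%R].

(** [S f] may take infinite values, as for maximal operators, and its values
    on null sets are irrelevant. *)
Definition sublinear D S : Prop :=
  [/\ (forall f : E -> R, D f -> measurable_fun [set: E] (S f)),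
      (forall f g : E -> R, D f -> D g ->
        {ae mu, forall x, `|S (f \+ g)%R x| <= `|S f x| + `|S g x|}) &
      (forall c (f : E -> R), D f ->
        {ae mu, forall x, `|S (fun y => c * f y)%R x| = `|c|%:E * `|S f x|})].

Definition size_condition (s : R) D S : Prop :=
  exists2 C : R, (0 < C)%R & forall (f : E -> R) a r, D f -> (0 < r)%R ->
    ereal_sup [set `|S (fun y => f y * \1_(~` eball a (2 * r)) y)%R x| |
      x in eball a r] <=
    C%:E * \sum_(1 <= k <oo)
      (((2 ^+ k.+1 * r) `^ (- (n.+1%:R / s)))%:E *
       (\int[mu]_(y in eball a (2 ^+ k.+1 * r)) (`|f y| `^ s)%:E) `^ s^-1).

(** Boundedness of [S] from the space of the measurable functions with finite
    [NX] to the space of those with finite [NY]. *)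
Definition bounded_operator (NX NY : (E -> \bar R) -> \bar R) S : Prop :=
  exists2 C : R, (0 < C)%R &
    forall f : E -> R, finite_norm_space NX f -> NY (S f) <= C%:E * NX (EFin \o f).

Definition psi_condition p w1 w2 (psi1 psi2 : E -> R -> R) : Prop :=
  ereal_sup [set (psi2 a r)^-1%:E *
      \int[lebesgue_measure]_(t in `]r, +oo[)
        (ereal_inf [set (psi1 a l)%:E * wmeasure w1 (eball a l) `^ p^-1 |
            l in `[t, +oo[]
         / wmeasure w2 (eball a t) `^ p^-1 * t^-1%:E) |
    a in [set: E] & r in [set r | (0 < r)%R]] < +oo.

End weighted_morrey.

(* Main.v *)
Require Import Defs.
From mathcomp Require Import all_boot all_order all_algebra.
From mathcomp Require Import all_classical all_reals all_analysis.
From mathcomp Require Import measurable_realfun.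
From mathcomp Require Import ess_sup_inf ring lra.

Import Order.TTheory GRing.Theory Num.Theory.
Import numFieldNormedType.Exports.

Local Open Scope classical_set_scope.
Local Open Scope ring_scope.

(** Fix a ball [B = B(a,r)] and split [f = f1 + f2] with [f1] the restriction of
    [f] to [B(a,2r)].  The assumed boundedness on Lebesgue spaces controls
    [S f1]; the size condition controls [S f2] on [B] by a constant [T], a sum
    over the dyadic dilates of [B] of normalised [L^s] norms of [f].  Hence the
    norm of [S f] on [B] is at most a multiple of the norm of [S f1] plus
    [T * w2(B)^(1/p)] (lemmas [wLnorm_split] and [wWLnorm_split]); this is the
    only place where the strong and the weak conclusion differ.

    The Muckenhoupt condition on [(w1^s, w2^s)] turns each normalised [L^s] norm
    into [L(k) := ||f||_{L^{p,w1}(B_k)} * w2(B_k)^(-1/p)], where [B_k] is the ball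
    [B(a, 2^(k+1) r)] (lemma [Muckenhoupt_local_average_bound]): Hoelder's
    inequality produces a power of [w1] in the dual Lebesgue space, and since
    [s >= 1], Jensen's inequality replaces the averages of [w2] and of the dual
    power of [w1] by the averages of their [s]-th powers that occur in the
    hypothesis.  The same estimate for the pair [(w2, w2)], applied to the
    indicator function of a ball, gives the doubling property of [w2] (lemma
    [local_average_bound_doubling]), so that the term coming from [f1] is
    dominated by a multiple of [L(0)].

    It remains to bound the sum of the [L(k)] by a multiple of
    [psi2(a,r) * ||f||_Morrey] (lemma [morrey_dyadic_sum]).  As
    [||f||_{L^{p,w1}(B(a,t))}] increases with [t], the Morrey norm bounds it not
    only through [psi1(a,t) * w1(B(a,t))^(1/p)] but through the infimum of this
    quantity over all larger radii.  By doubling, the resulting sum is at most a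
    constant times the integral in the hypothesis on [psi1] and [psi2].

    Lebesgue measure in dimension [n+1] enters only through the measurability of
    balls and through bounds of the volume of a ball of radius [r] from above
    and below by multiples of [r^(n+1)]; both follow from the exact value of the
    measure of a box. *)

(** * The measure of a box and the measurability of coordinates *)

Section lebesgue_boxes.
Context {R : realType} {n : nat}.
Implicit Types I : 'rV[R]_n.+1 * 'rV[R]_n.+1.
Local Open Scope ereal_scope.

Let side I (i : 'I_n.+1) : R := Num.max 0%R (I.2 ord0 i - I.1 ord0 i)%R.

(** The indicator function of the box, integrated over the first [j]
    coordinates: for [j = 0] it is the indicator itself, for [j = n+1] the
    volume. *)
Definition partly_integrated_box (j : nat) I (x : 'rV[R]_n.+1) : \bar R :=
  (\prod_(i < n.+1) if (i < j)%N then side I i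
                    else (I.1 ord0 i < x ord0 i <= I.2 ord0 i)%R%:R)%R%:E.

Lemma partly_integrated_box_ge0 j I x : 0 <= partly_integrated_box j I x.
Proof.
rewrite lee_fin prodr_ge0// => i _; case: ifP => // _.
by rewrite le_max lexx.
Qed.

Lemma integral_itvoc_indicator (a b c : R) : (0 <= c)%R ->
  \int[lebesgue_measure]_t (((a < t <= b)%R%:R * c)%R%:E)
  = (Num.max 0 (b - a) * c)%R%:E.
Proof.
move=> c0; have mab : measurable `]a, b]%classic by exact: measurable_itv.
transitivity (c%:E * \int[lebesgue_measure]_t (\1_(`]a, b]%classic) t)%:E).
  rewrite -ge0_integralZl//; last by apply/measurable_EFinP.
  apply: eq_integral => t _; rewrite -EFinM mulrC indicE /=.
  by rewrite mem_setE in_itv.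
rewrite integral_indic// setIT.
rewrite [X in _ * X](lebesgue_measure_itv `]a, b])/= lte_fin mulrC EFinM.
congr (_ * _); case: ltP => ab; rewrite -?EFinB ?EFinM.
  by rewrite max_r// subr_ge0 ltW.
by rewrite max_l// subr_le0.
Qed.

Definition replace_coord (j : 'I_n.+1) (x : 'rV[R]_n.+1) t : 'rV[R]_n.+1 :=
  \row_i (if i == j then t else x ord0 i).

Let others I (j : 'I_n.+1) (x : 'rV[R]_n.+1) : R :=
  (\prod_(i < n.+1 | i != j) if (i < j.+1)%N then side I i
                    else (I.1 ord0 i < x ord0 i <= I.2 ord0 i)%R%:R)%R.

Let others_ge0 I j x : (0 <= others I j x)%R.
Proof.
by rewrite prodr_ge0// => i _; case: ifP => // _; rewrite le_max lexx.
Qed.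

Let partly_integrated_box_replace I (j : 'I_n.+1) x t :
  partly_integrated_box j I (replace_coord j x t) =
  ((I.1 ord0 j < t <= I.2 ord0 j)%R%:R * others I j x)%R%:E.
Proof.
rewrite /partly_integrated_box (bigD1 j)//= ltnn mxE eqxx; congr (_ * _)%:E.
apply: eq_bigr => i ij; rewrite mxE (negbTE ij) ltnS.
by rewrite [in RHS]leq_eqVlt -[(i == j :> nat)]/(i == j) (negbTE ij).
Qed.

Lemma integral_partly_integrated_box I (j : 'I_n.+1) x :
  \int[lebesgue_measure]_t partly_integrated_box j I (replace_coord j x t) =
  partly_integrated_box j.+1 I x.
Proof.
under eq_integral do rewrite partly_integrated_box_replace.
rewrite integral_itvoc_indicator//.
by rewrite /partly_integrated_box (bigD1 j)//= ltnSn.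
Qed.

Lemma measurable_partly_integrated_box I (j : 'I_n.+1) x :
  measurable_fun [set: R]
    (fun t => partly_integrated_box j I (replace_coord j x t)).
Proof.
under eq_fun do rewrite partly_integrated_box_replace.
apply/measurable_EFinP/measurable_funM => //.
rewrite (_ : (fun _ => _) = \1_(`]I.1 ord0 j, I.2 ord0 j]%classic) :> (R -> R)).
  exact: measurable_indic.
by apply/funext => t; rewrite indicE /= mem_setE in_itv.
Qed.

(** The indicator of the box is at most the sum of those of the covering boxes,
    and this domination survives integration over one coordinate after the
    other, since the integral of a nonnegative series is the series of the
    integrals.  No compactness and no finite subcover is involved. *)
Lemma box_volume_le_cover I (u : nat -> 'rV[R]_n.+1 * 'rV[R]_n.+1) :
  box I `<=` \bigcup_k box (u k) -> box_volume I <= \sum_(k <oo) box_volume (u k).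
Proof.
move=> Iu.
have step : forall j x, (j <= n.+1)%N -> partly_integrated_box j I x <=
    \sum_(k <oo) partly_integrated_box j (u k) x.
  elim=> [x _|j ih x jn].
    have [Ix|Ix] := pselect (box I x).
      have [k _ ukx] := Iu _ Ix.
      apply: (@le_trans _ _ (partly_integrated_box 0 (u k) x)).
        rewrite /partly_integrated_box !big1// => i _ /=; first by rewrite ukx.
        by rewrite Ix.
      rewrite (nneseriesD1 (n := k))//; last first.
        by move=> *; exact: partly_integrated_box_ge0.
      rewrite leeDl//; apply: nneseries_ge0 => *.
      exact: partly_integrated_box_ge0.
    apply: (@le_trans _ _ 0); last first.
      by apply: nneseries_ge0 => *; exact: partly_integrated_box_ge0.
    have [i Ixi] : exists i, ~~ (I.1 ord0 i < x ord0 i <= I.2 ord0 i)%R.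
      by apply: contrapT => /forallNP h; apply: Ix => i; apply/negPn/negP; exact: h.
    by rewrite /partly_integrated_box (bigD1 i)//= (negbTE Ixi) mul0r.
  pose J := Ordinal jn.
  rewrite -[X in X <= _](integral_partly_integrated_box I J).
  under eq_eseriesr do rewrite -(integral_partly_integrated_box _ J).
  rewrite -integral_nneseries//=; last 2 first.
  - by move=> k; exact: (measurable_partly_integrated_box _ J).
  - by move=> *; exact: partly_integrated_box_ge0.
  apply: ge0_le_integral => //.
  - by move=> *; exact: partly_integrated_box_ge0.
  - exact: (measurable_partly_integrated_box _ J).
  - apply: (ge0_emeasurable_sum (P := xpredT)) => *.
      exact: partly_integrated_box_ge0.
    exact: (measurable_partly_integrated_box _ J).
  - by move=> t _; exact: ih (ltnW jn).
have full K : partly_integrated_box n.+1 K 0%R = box_volume K.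
  by rewrite /partly_integrated_box /box_volume; congr (_%:E);
     apply: eq_bigr => i _; rewrite ltn_ord.
have := step n.+1 0%R (leqnn _); rewrite full.
by under eq_eseriesr do rewrite full.
Qed.

Lemma lebesgue_outer_box I : lebesgue_outer (box I) = box_volume I.
Proof.
apply/eqP; rewrite eq_le; apply/andP; split; last first.
  by apply: le_ereal_inf_tmp => _ [u Iu <-]; exact: box_volume_le_cover.
apply: ereal_inf_lbound.
(* the box covers itself; the cover is completed by empty boxes *)
exists (fun k => if k == 0%N then I else (0, 0)%R).
  by move=> x Ix; exists 0%N.
rewrite (nneseriesD1 (n := 0%N))//; last by move=> *; exact: box_volume_ge0.
rewrite eseries0 ?adde0// => -[//|k] _ _ /=.
rewrite /box_volume /= big_ord_recl.
by rewrite subrr maxxx mul0r.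
Qed.

(** Cutting the boxes of a cover along the hyperplane gives a cover of the part
    below and one of the part above, of the same total volume; this is the
    Caratheodory criterion. *)
Lemma measurable_coord_le (i : 'I_n.+1) (c : R) :
  measurable ([set x | (x ord0 i <= c)%R] : set (rvec R n)).
Proof.
apply: le_caratheodory_measurable => X.
apply: le_ereal_inf_tmp => _ [u Xu <-].
pose low k : 'rV[R]_n.+1 * 'rV[R]_n.+1 := ((u k).1,
  \row_l if l == i then Num.min ((u k).2 ord0 i) c else (u k).2 ord0 l).
pose high k : 'rV[R]_n.+1 * 'rV[R]_n.+1 := (
  \row_l if l == i then Num.max ((u k).1 ord0 i) c else (u k).1 ord0 l, (u k).2).
rewrite [leRHS](_ : _ = \sum_(k <oo) box_volume (low k) +
                        \sum_(k <oo) box_volume (high k)).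
  apply: leeD; apply: ereal_inf_lbound.
    exists low => // x [/Xu[k _ ukx] xc]; exists k => // l; rewrite mxE.
    case: eqP => [->|_]; rewrite ?le_min ?ukx//= xc.
    by have := ukx i => /andP[-> ->].
  exists high => // x [/Xu[k _ ukx] /= /negP]; rewrite -ltNge => xc.
  exists k => // l; rewrite mxE.
  case: eqP => [->|_]; rewrite ?ukx//= gt_max xc.
  by have := ukx i => /andP[-> ->].
rewrite -nneseriesD; try by move=> *; exact: box_volume_ge0.
apply: eq_eseriesr => k _; rewrite /box_volume -EFinD; congr (_%:E).
rewrite !(bigD1 i (P := xpredT))//= !mxE eqxx.
under [in X in _ = (X + _)%R]eq_bigr => l li do rewrite mxE (negbTE li).
under [in X in _ = (_ + X)%R]eq_bigr => l li do rewrite mxE (negbTE li).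
rewrite -mulrDl; congr (_ * _)%R.
move: ((u k).1 _ _) ((u k).2 _ _) => a b.
rewrite /Num.max /Num.min; do ! case: ifP; lra.
Qed.

Lemma measurable_coord (i : 'I_n.+1) :
  measurable_fun [set: rvec R n] (fun x => x ord0 i : R).
Proof.
apply: (measurability _ (RGenOInfty.measurableE R)) => //.
move=> _ [_ [c ->] <-]; rewrite setTI.
rewrite (_ : _ @^-1` _ = ~` [set x : rvec R n | (x ord0 i <= c)%R]).
  by apply: measurableC; exact: measurable_coord_le.
by apply/seteqP; split => x /=; rewrite in_itv/= andbT ltNge => /negP.
Qed.

End lebesgue_boxes.

(** * Balls and the weights of balls *)

Section integral_facts.
Local Open Scope ereal_scope.

(** The integral of a nonnegative function is the supremum of those of the
    simple functions below it, hence monotone whether or not the functions are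
    measurable.  This spares the measurability of the integrand of
    [psi_condition] as a function of the radius. *)
Lemma ge0_le_integral_nonmeasurable d (T : measurableType d) (R : realType)
    (m : {measure set T -> \bar R}) (D D' : set T) (f g : T -> \bar R) :
  D `<=` D' -> (forall x, 0 <= f x) -> (forall x, D' x -> 0 <= g x) ->
  (forall x, D x -> f x <= g x) ->
  \int[m]_(x in D) f x <= \int[m]_(x in D') g x.
Proof.
move=> DD' f0 g0 fg; rewrite !ge0_integralE//.
apply: ereal_sup_le => _ [h hf <-]; exists h => // x.
apply: le_trans (hf x) _; rewrite !patchE.
case: ifPn => xD; last by case: ifPn => // /set_mem/g0.
by rewrite (mem_set (DD' _ (set_mem xD))) fg//; exact: set_mem.
Qed.

Lemma integral_gt0 d (T : measurableType d) (R : realType)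
    (m : {measure set T -> \bar R}) (A : set T) (f : T -> \bar R) :
  measurable A -> measurable_fun A f -> (forall x, 0 <= f x) ->
  {ae m, forall x, 0 < f x} -> 0 < m A -> 0 < \int[m]_(x in A) f x.
Proof.
move=> mA mf f0 fgt0 muA; rewrite lt0e integral_ge0// andbT.
apply/eqP => int0; have : \int[m]_(x in A) `|f x| = 0.
  by rewrite -[RHS]int0; apply: eq_integral => x _; rewrite gee0_abs.
move/(ae_eq_integral_abs m mA mf) => f_eq0.
have negA : {ae m, forall x, ~ A x}.
  apply: filterS2 f_eq0 fgt0 => x fx0 fx Ax.
  by move: fx; rewrite (fx0 Ax) ltxx.
suff A0 : m A = 0 by rewrite A0 ltxx in muA.
have [N [mN N0 AN]] := negA; apply/eqP; rewrite eq_le measure_ge0 andbT -N0.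
by apply: le_measure; rewrite ?inE// => x Ax; apply: AN => /(_ Ax).
Qed.

End integral_facts.

Section balls.
Context {R : realType} {n : nat}.
Local Notation E := (rvec R n).
Local Notation mu := (@lebesgue R n).
Implicit Types (a x : E) (r : R) (w : E -> R).
Local Open Scope ereal_scope.

Lemma measurable_eball a r : measurable (eball a r).
Proof.
have mN : measurable_fun [set: E] (fun x => euclidean_norm (x - a)%R).
  have mS : measurable_fun [set: R] (Num.sqrt : R -> R).
    apply: continuous_measurable_fun => x; exact: sqrt_continuous.
  apply: (measurableT_comp mS).
  apply: measurable_sum => i; apply: measurable_funX.
  under eq_fun do rewrite !mxE.
  by apply: measurable_funB; [exact: measurable_coord|exact: measurable_cst].
have := mN measurableT _ (measurable_itv `]-oo, r[).
by rewrite setTI; congr measurable.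
Qed.

Lemma le_eball a r r' : (r <= r')%R -> eball a r `<=` eball a r'.
Proof. by move=> rr' x /= /lt_le_trans; exact. Qed.

Lemma coord_le_euclidean_norm x i : (`|x ord0 i| <= euclidean_norm x)%R.
Proof.
rewrite -sqrtr_sqr ler_wsqrtr// (bigD1 i)//= lerDl.
by apply: sumr_ge0 => j _; exact: sqr_ge0.
Qed.

Definition cube a r : 'rV[R]_n.+1 * 'rV[R]_n.+1 :=
  (\row_i (a ord0 i - r), \row_i (a ord0 i + r))%R.

Lemma box_volume_cube a r : (0 <= r)%R ->
  box_volume (cube a r) = ((r *+ 2) ^+ n.+1)%:E.
Proof.
move=> r0; rewrite /box_volume; under eq_bigr => i _.
  rewrite !mxE opprB addrC addrA subrK -mulr2n.
  rewrite max_r ?mulrn_wge0//; over.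
by rewrite prodr_const card_ord.
Qed.

Lemma eball_sub_cube a r : eball a r `<=` box (cube a r).
Proof.
move=> x xar i; rewrite !mxE.
have /= := coord_le_euclidean_norm (x - a)%R i; rewrite !mxE.
move=> /le_lt_trans/(_ xar); rewrite ltr_norml => /andP[h1 h2].
by apply/andP; split; lra.
Qed.

(** The half side [r / (n+2)] is chosen because the squared norm of a vector of
    the cube is then at most [(n+1) / (n+2)^2] times [r^2]. *)
Lemma cube_sub_eball a r : (0 < r)%R -> box (cube a (r / n.+2%:R)) `<=` eball a r.
Proof.
move=> r0 x xar; rewrite /eball /mkset /euclidean_norm.
rewrite -[ltRHS](ger0_norm (ltW r0)) -[ltRHS]sqrtr_sqr.
rewrite ltr_sqrt ?exprn_gt0//.
apply: (@le_lt_trans _ _ (\sum_(i < n.+1) (r / n.+2%:R) ^+ 2)%R).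
  apply: ler_sum => i _; rewrite -[leLHS]real_normK ?num_real// lerXn2r ?nnegrE//.
    by rewrite divr_ge0// ltW.
  have := xar i; rewrite !mxE ler_norml => /andP[h1 h2].
  by rewrite lerBlDl h2 andbT lerBrDl ltW.
rewrite big_const_ord iter_addr addr0 expr_div_n -[ltLHS]mulr_natr -mulrA.
rewrite gtr_pMr ?exprn_gt0// mulrC.
rewrite ltr_pdivrMr ?exprn_gt0// mul1r -natrX ltr_nat.
by rewrite -mulnn leq_pmulr.
Qed.

Lemma lebesgue_eball_le a r : (0 < r)%R ->
  mu (eball a r) <= ((r *+ 2) ^+ n.+1)%:E.
Proof.
move=> r0; rewrite -(box_volume_cube a r (ltW r0)) -lebesgue_outer_box.
by apply: le_lebesgue_outer; exact: eball_sub_cube.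
Qed.

Lemma lebesgue_eball_ge a r : (0 < r)%R ->
  ((r / n.+2%:R *+ 2) ^+ n.+1)%:E <= mu (eball a r).
Proof.
have r1 : (0 < r -> 0 <= r / n.+2%:R)%R by move=> ?; rewrite divr_ge0// ltW.
move=> r0; rewrite -(box_volume_cube a _ (r1 r0)) -lebesgue_outer_box.
by apply: le_lebesgue_outer; exact: cube_sub_eball.
Qed.

Lemma lebesgue_eball_gt0 a r : (0 < r)%R -> 0 < mu (eball a r).
Proof.
move=> r0; apply: lt_le_trans (lebesgue_eball_ge a r r0).
by rewrite lte_fin exprn_gt0// mulrn_wgt0// divr_gt0.
Qed.

Lemma lebesgue_eball_lty a r : (0 < r)%R -> mu (eball a r) < +oo.
Proof. by move=> r0; apply: le_lt_trans (lebesgue_eball_le a r r0) (ltry _). Qed.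

Lemma integral_eball_gt0 (f : E -> R) a r : (0 < r)%R ->
  measurable_fun [set: E] f -> (forall x, (0 <= f x)%R) ->
  {ae mu, forall x, (0 < f x)%R} -> 0 < \int[mu]_(x in eball a r) (f x)%:E.
Proof.
move=> r0 mf f0 fgt0; apply: integral_gt0.
- exact: measurable_eball.
- by apply/measurable_EFinP; exact: measurable_funTS.
- by move=> x; rewrite lee_fin.
- exact: fgt0.
- exact: lebesgue_eball_gt0.
Qed.

Lemma wmeasure_eball_gt0 w a r : weight w -> (0 < r)%R ->
  0 < wmeasure w (eball a r).
Proof. by case=> mw w0 wgt0 _ r0; exact: integral_eball_gt0. Qed.

(** Weights have finite integral on compact sets, and a ball lies in a closed
    cube. *)
Lemma wmeasure_eball_lty w a r : weight w -> wmeasure w (eball a r) < +oo.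
Proof.
move=> [mw w0 _ wK].
pose J i : set R := [set` `[(a ord0 i - r)%R, (a ord0 i + r)%R]].
pose K : set E := [set v | forall i, J i (v ord0 i)].
have cK : compact K.
  apply: (@rV_compact _ _ J) => i; exact: segment_compact.
apply: le_lt_trans (wK K cK).
apply: ge0_le_integral_nonmeasurable => [x xar i|x|x _|x _]; rewrite ?lee_fin//.
rewrite /J/= in_itv/=.
have := eball_sub_cube _ _ _ xar i; rewrite !mxE => /andP[h1 h2].
by rewrite h2 ltW.
Qed.

Lemma wmeasure_eball_fin_num w a r : weight w ->
  wmeasure w (eball a r) \is a fin_num.
Proof.
move=> hw; rewrite ge0_fin_numE ?wmeasure_eball_lty//.
by apply: integral_ge0 => x _; rewrite lee_fin; case: hw.
Qed.

End balls.

(** * The Muckenhoupt condition as an inequality between local norms *)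

Section hoelder_interpolation.
Local Open Scope ereal_scope.

Lemma measurable_powR_comp {d} {T : measurableType d} {R : realType} (A : set T)
    (f : T -> R) (t : R) :
  measurable_fun A f -> measurable_fun A (fun x => (f x `^ t)%R).
Proof. by move=> mf; apply: (measurableT_comp (measurable_powR t)). Qed.

(** Hoelder's inequality with exponents [1/t] and [1/(1-t)], in a form that
    stays true for [t = 1], so that [s = 1] needs no separate treatment. *)
Lemma hoelder_powR {d} {T : measurableType d} {R : realType}
    (m : {measure set T -> \bar R}) (A : set T) (u v : T -> R) (t : R) :
  measurable A -> measurable_fun [set: T] u -> measurable_fun [set: T] v ->
  (forall x, 0 <= u x)%R -> (forall x, 0 <= v x)%R -> (0 < t <= 1)%R ->
  \int[m]_(x in A) (u x `^ t * v x `^ (1 - t))%:E <=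
  (\int[m]_(x in A) (u x)%:E) `^ t * (\int[m]_(x in A) (v x)%:E) `^ (1 - t).
Proof.
move=> mA um vm u0 v0 /andP[t0]; rewrite le_eqVlt => /predU1P[->|t1].
  rewrite subrr poweRe0 mule1 poweRe1; last first.
    by apply: integral_ge0 => x _; rewrite lee_fin.
  by under eq_integral do rewrite powRr0 mulr1 powRr1//.
have s0 : (0 < 1 - t)%R by rewrite subr_gt0.
have rootE (h : T -> R) (r : R) : (0 < r)%R -> (forall x, 0 <= h x)%R ->
    'N[m]_(r^-1)%:E[EFin \o (fun x => h x `^ r * \1_A x)%R] =
    (\int[m]_(x in A) (h x)%:E) `^ r.
  move=> r0 h0; rewrite unlock invrK [in RHS]integral_mkcond; congr (_ `^ _).
  apply: eq_integral => x _; rewrite /= patchE indicE.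
  case: ifPn => xA; rewrite ?mulr1 ?mulr0.
    by rewrite ger0_norm ?powR_ge0// -powRrM divff ?gt_eqF// powRr1.
  by rewrite normr0 powR0// invr_eq0 gt_eqF.
have mI : measurable_fun [set: T] (\1_A : T -> R) by exact: measurable_indic.
have mUI (h : T -> R) r : measurable_fun [set: T] h ->
    measurable_fun [set: T] (fun x => h x `^ r * \1_A x)%R.
  by move=> mh; apply: measurable_funM => //; exact: measurable_powR_comp.
have t0' : (0 < t^-1)%R by rewrite invr_gt0.
have s0' : (0 < (1 - t)^-1)%R by rewrite invr_gt0.
have ts : (t^-1^-1 + (1 - t)^-1^-1 = 1)%R by rewrite !invrK addrCA subrr addr0.
have := hoelder m (mUI u t um) (mUI v (1 - t)%R vm) t0' s0' ts.
rewrite !rootE//; apply: le_trans.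
rewrite Lnorm1 [in leLHS]integral_mkcond le_eqVlt; apply/orP; left; apply/eqP.
apply: eq_integral => x _; rewrite patchE/= indicE.
case: ifPn => xA; rewrite ?mulr1 ?mulr0 ?normr0//.
by rewrite ger0_norm// mulr_ge0// powR_ge0.
Qed.

End hoelder_interpolation.

Section muckenhoupt_real_exponents.
Context {R : realType}.

Lemma powR_ball_volume (N : nat) (r s : R) : 0 < r ->
  r `^ (- (N%:R / s)) * ((r *+ 2) ^+ N) `^ s^-1 = (2 ^+ N) `^ s^-1.
Proof.
move=> r0; rewrite -[r *+ 2]mulr_natl exprMn powRM ?exprn_ge0 ?ltW//.
rewrite mulrCA -[in X in _ * (_ * X)](powR_mulrn N (ltW r0)) -powRrM powRN.
by rewrite mulVf ?mulr1// gt_eqF// powR_gt0.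
Qed.

(** The exponents of the weighted estimate fit together: after taking
    logarithms the three hypotheses are linear inequalities, and the conclusion
    is their combination with coefficients [(1 - s/p)/s], [1/p] and [1/(ps)].
    In the application [b] is the volume of the ball, [W] and [V] are the
    integrals of [w2^s] and of [w1^(-s/(q-1))] with [q = p/s], and [w], [V'] are
    the same integrals without the power [s]. *)
Lemma Muckenhoupt_exponents (p s b W V V' w K : R) :
  1 < p -> 1 <= s < p ->
  0 < b -> 0 < W -> 0 < V -> 0 < V' -> 0 < w -> 0 < K ->
  V' <= V `^ s^-1 * b `^ (1 - s^-1) ->
  w <= W `^ s^-1 * b `^ (1 - s^-1) ->
  (b^-1 * W) * (b^-1 * V) `^ (p / s - 1) <= K ->
  V' `^ ((1 - (p / s)^-1) * s^-1) * w `^ p^-1 <= K `^ (p^-1 / s) * b `^ s^-1.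
Proof.
move=> p1 /andP[s1 sp] b0 W0 V0 V'0 w0 K0.
have s0 : 0 < s by lra.
have p0 : 0 < p by lra.
rewrite -ler_ln ?posrE ?mulr_gt0 ?powR_gt0// lnM ?posrE ?powR_gt0// !ln_powR => hV.
rewrite -ler_ln ?posrE ?mulr_gt0 ?powR_gt0// lnM ?posrE ?powR_gt0// !ln_powR => hw.
rewrite -ler_ln ?posrE ?mulr_gt0 ?powR_gt0 ?mulr_gt0 ?invr_gt0//.
rewrite lnM ?posrE ?mulr_gt0 ?powR_gt0 ?mulr_gt0 ?invr_gt0//.
rewrite ln_powR !lnM ?posrE ?invr_gt0// lnV ?posrE// => hK.
rewrite -ler_ln ?posrE ?mulr_gt0 ?powR_gt0// !lnM ?posrE ?powR_gt0// !ln_powR.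
move: (ln b) (ln V) (ln V') (ln w) (ln W) (ln K) hV hw hK => {b0 V0 V'0 w0 W0 K0}.
move=> b0 v v' w0 w' k hV hw hK.
have c1 : 0 <= (1 - (p / s)^-1) * s^-1.
  apply: mulr_ge0; last by rewrite invr_ge0 ltW.
  by rewrite subr_ge0 invf_div ler_pdivrMr// mul1r ltW.
have c3 : 0 <= p^-1 / s by rewrite divr_ge0 ?invr_ge0// ltW.
have c2 : 0 <= p^-1 by rewrite invr_ge0 ltW.
have h1 := ler_wpM2l c1 hV; have h2 := ler_wpM2l c2 hw.
have h3 := ler_wpM2l c3 hK.
apply: le_trans (lerD h1 h2) _.
rewrite -lerBlDr; apply: le_trans h3.
rewrite le_eqVlt; apply/orP; left; apply/eqP.
by field; rewrite !gt_eqF.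
Qed.

(** The factorisation of [|f|^s] to which Hoelder's inequality is applied, with
    exponent [q = p/s]: the weight is inserted in the first factor and its dual
    power [v^(-1/(q-1))] compensates for it in the second. *)
Lemma powR_split_weight (p s u v : R) : 0 < s -> s < p -> 0 <= u -> 0 < v ->
  u `^ s = (u `^ p * v) `^ (p / s)^-1 *
           (v `^ (- (p / s - 1)^-1)) `^ (1 - (p / s)^-1).
Proof.
move=> s0 sp u0 v0; have p0 : 0 < p := lt_trans s0 sp.
rewrite powRM ?powR_ge0 ?ltW// -!powRrM invf_div mulrCA divff ?gt_eqF// mulr1.
rewrite -mulrA -powRD; last by apply/implyP => _; rewrite gt_eqF.
rewrite (_ : s / p + _ = 0) ?powRr0 ?mulr1//.
by field; rewrite mulN1r subr_eq0 !gt_eqF.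
Qed.

End muckenhoupt_real_exponents.

Section muckenhoupt.
Context {R : realType} {n : nat}.
Local Notation E := (rvec R n).
Local Notation mu := (@lebesgue R n).
Implicit Types (a : E) (r p s : R) (w : E -> R).
Local Open Scope ereal_scope.

Lemma weight_powR w s : weight w ->
  [/\ measurable_fun [set: E] (fun x => (w x `^ s)%R),
      (forall x, (0 <= w x `^ s)%R) &
      {ae mu, forall x, (0 < w x `^ s)%R}].
Proof.
move=> [mw w0 wgt0 _]; split; first exact: measurable_powR_comp.
  by move=> x; exact: powR_ge0.
by apply: filterS wgt0 => x; exact: powR_gt0.
Qed.

Lemma wLnormE p w A (f : E -> R) : wLnorm p w A (EFin \o f) =
  (\int[mu]_(x in A) (`|f x| `^ p * w x)%:E) `^ p^-1.
Proof. by []. Qed.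

Lemma lebesgue_eball_fin a r : (0 < r)%R ->
  exists2 b : R, (0 < b <= (r *+ 2) ^+ n.+1)%R & mu (eball a r) = b%:E.
Proof.
move=> r0; have b0 := lebesgue_eball_gt0 a r r0.
have bE : mu (eball a r) = (fine (mu (eball a r)))%:E.
  by rewrite fineK// ge0_fin_numE ?ltW// lebesgue_eball_lty.
exists (fine (mu (eball a r))) => //.
by rewrite -lte_fin -lee_fin -bE b0 lebesgue_eball_le.
Qed.

Lemma wmeasure_eball_fin w a r : weight w -> (0 < r)%R ->
  exists2 v : R, (0 < v)%R & wmeasure w (eball a r) = v%:E.
Proof.
move=> hw r0; have v0 := wmeasure_eball_gt0 w a r hw r0.
have vE := fineK (wmeasure_eball_fin_num w a r hw).
by exists (fine (wmeasure w (eball a r))) => //; rewrite -lte_fin vE.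
Qed.

Lemma gt0_lty_EFin (x : \bar R) : 0 < x -> x < +oo ->
  exists2 v : R, (0 < v)%R & x = v%:E.
Proof. by case: x => // v v0 _; exists v. Qed.

(** The form in which the Muckenhoupt condition is used: a normalised [L^s] norm
    is bounded by a normalised weighted [L^p] norm.  The factor [r^(-(n+1)/s)]
    plays the role of the power [-1/s] of the volume of the ball. *)
Definition local_average_bound p s w1 w2 (C : R) :=
  forall (f : E -> R) a r, measurable_fun [set: E] f -> (0 < r)%R ->
    (r `^ (- (n.+1%:R / s)))%:E *
      (\int[mu]_(y in eball a r) (`|f y| `^ s)%:E) `^ s^-1 <=
    C%:E * (wLnorm p w1 (eball a r) (EFin \o f) *
            wmeasure w2 (eball a r) `^ (- p^-1)).

(** With [q = p/s], Hoelder's inequality bounds the [L^s] norm of [f] by its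
    [L^{p,w1}] norm and the integral of [w1^(-1/(q-1))].  Jensen's inequality
    passes from this integral and from [w2(B)] to the integrals of the [s]-th
    powers, whose product the hypothesis controls. *)
Lemma Muckenhoupt_local_average_bound_gt1 p s w1 w2 : (1 < p)%R -> (1 <= s < p)%R ->
  weight w1 -> weight w2 ->
  Muckenhoupt (p / s) (fun x => (w1 x `^ s)%R) (fun x => (w2 x `^ s)%R) ->
  exists2 C : R, (0 < C)%R & local_average_bound p s w1 w2 C.
Proof.
move=> p1 hsp hw1 hw2 [K K0 AK].
have /andP[s1 sp] := hsp.
have s0 : (0 < s)%R by lra.
have p0 : (0 < p)%R by lra.
have q1 : (1 < p / s)%R by rewrite ltr_pdivlMr// mul1r.
exists (K `^ (p^-1 / s) * (2 ^+ n.+1) `^ s^-1)%R.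
  by rewrite mulr_gt0 ?powR_gt0// exprn_gt0.
have [mw1 w10 w1gt0 _] := hw1.
move=> f a r mf r0; set B := eball a r.
have mf' t : measurable_fun [set: E] (fun x => `|f x| `^ t)%R.
  by apply: measurable_powR_comp; exact: measurableT_comp.
have mF : measurable_fun [set: E] (fun x => `|f x| `^ p * w1 x)%R.
  exact: measurable_funM (mf' p) mw1.
have Fx0 x : (0 <= `|f x| `^ p * w1 x)%R by rewrite mulr_ge0// powR_ge0.
have mB : measurable B := measurable_eball a r.
have [b /andP[b0 br] bE] := lebesgue_eball_fin a r r0.
have [om om0 omE] := wmeasure_eball_fin w2 a r hw2 r0.
have := AK a r r0; rewrite -/B (gt_eqF q1) /average bE inver gt_eqF//.
set W := \int[mu]_(x in B) _; set V := \int[mu]_(x in B) _ => AB.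
have [mW W0 Wgt0] := weight_powR w2 s hw2.
have [mV V0 Vgt0] := weight_powR w1 (s * - (p / s - 1)^-1)%R hw1.
have [mV' V'0 V'gt0] := weight_powR w1 (- (p / s - 1)^-1)%R hw1.
have VE : V = \int[mu]_(x in B) (w1 x `^ (s * - (p / s - 1)^-1))%:E.
  by apply: eq_integral => x _; rewrite powRrM.
have W_gt0 : 0 < W by exact: integral_eball_gt0 r0 mW W0 Wgt0.
have V_gt0 : 0 < V by rewrite VE; exact: integral_eball_gt0 r0 mV V0 Vgt0.
have ib0 : 0 < b^-1%:E by rewrite lte_fin invr_gt0.
(* both factors of the bounded product are positive, so neither is infinite *)
have W_lty : W < +oo.
  rewrite ltey; apply/eqP => Woo; move: AB; rewrite Woo (gt0_muley ib0) gt0_mulye.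
    by rewrite leye_eq.
  by apply: poweR_gt0; exact: mule_gt0 ib0 V_gt0.
have V_lty : V < +oo.
  rewrite ltey; apply/eqP => Voo; move: AB.
  rewrite Voo [b^-1%:E * +oo](gt0_muley ib0) poweRyr.
    by rewrite gt0_muley ?leye_eq//; exact: mule_gt0 ib0 W_gt0.
  by rewrite subr_eq0 (gt_eqF q1).
have [W' W'0 W'E] := gt0_lty_EFin W W_gt0 W_lty.
have [V1 V10 V1E] := gt0_lty_EFin V V_gt0 V_lty.
have {}AB : ((b^-1 * W') * (b^-1 * V1) `^ (p / s - 1) <= K)%R.
  by rewrite -lee_fin EFinM EFinM -poweR_EFin EFinM -W'E -V1E.
have is01 : (0 < s^-1 <= 1)%R by rewrite invr_gt0 s0 invf_le1.
have jensen (h : E -> R) : measurable_fun [set: E] h -> (forall x, 0 <= h x)%R ->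
    \int[mu]_(x in B) (h x)%:E <=
    (\int[mu]_(x in B) (h x `^ s)%:E) `^ s^-1 * b%:E `^ (1 - s^-1).
  move=> mh h0; have m1 : measurable_fun [set: E] (cst 1%R : E -> R).
    exact: measurable_cst.
  have := hoelder_powR mu B (fun x => h x `^ s)%R (cst 1%R) s^-1 mB
    (measurable_powR_comp _ _ _ mh) m1
    (fun x => powR_ge0 _ _) (fun x => ler01) is01.
  have -> : \int[mu]_(x in B) (cst 1%R x)%:E = b%:E.
    transitivity (1 * mu B); last by rewrite mul1e bE.
    exact: (@integral_cst _ _ _ mu B mB 1).
  apply: le_trans.
  rewrite le_eqVlt; apply/orP; left; apply/eqP; apply: eq_integral => x _.
  by rewrite powR1 mulr1 -powRrM divff ?gt_eqF// powRr1.
have [mw2 w20 _ _] := hw2.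
have omW : (om <= W' `^ s^-1 * b `^ (1 - s^-1))%R.
  rewrite -lee_fin EFinM -!poweR_EFin -W'E -omE; exact: jensen.
have V'V := jensen _ mV' V'0.
have V'_gt0 : 0 < \int[mu]_(x in B) (w1 x `^ (- (p / s - 1)^-1))%:E.
  exact: integral_eball_gt0.
have V'E : \int[mu]_(x in B) (w1 x `^ (- (p / s - 1)^-1) `^ s)%:E = V.
  by apply: eq_integral => x _; rewrite powRAC.
rewrite V'E V1E !poweR_EFin -EFinM in V'V.
have [V' V'_0 V'EE] := gt0_lty_EFin _ V'_gt0 (le_lt_trans V'V (ltry _)).
rewrite V'EE lee_fin in V'V.
have key := Muckenhoupt_exponents p s b W' V1 V' om K p1 hsp b0 W'0 V10 V'_0 om0
  K0 V'V omW AB.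
(* the [L^{p,w1}] norm of [f] may be infinite, so [F] stays an extended real *)
set F := \int[mu]_(x in B) (`|f x| `^ p * w1 x)%:E.
have iq01 : (0 < (p / s)^-1 <= 1)%R.
  have q0 := lt_trans ltr01 q1.
  by rewrite invr_gt0 q0 (invf_le1 q0) (ltW q1).
have phi : \int[mu]_(y in B) (`|f y| `^ s)%:E <=
    F `^ (p / s)^-1 * V'%:E `^ (1 - (p / s)^-1).
  rewrite -V'EE.
  apply: le_trans (hoelder_powR mu B _ _ _ mB mF mV' Fx0 V'0 iq01).
  have mFV : measurable_fun [set: E] (fun x => (`|f x| `^ p * w1 x) `^ (p / s)^-1 *
      (w1 x `^ (- (p / s - 1)^-1)) `^ (1 - (p / s)^-1))%R.
    exact: measurable_funM (measurable_powR_comp _ _ _ mF)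
      (measurable_powR_comp _ _ _ mV').
  apply: ae_ge0_le_integral; first exact: mB.
  - by move=> x _; rewrite lee_fin powR_ge0.
  - by apply/measurable_EFinP/measurable_funTS; exact: mf'.
  - move=> x _; rewrite lee_fin; apply: mulr_ge0; exact: powR_ge0.
  - by apply/measurable_EFinP/measurable_funTS; exact: mFV.
  - apply: filterS w1gt0 => x w1x _.
    by rewrite lee_fin -(powR_split_weight p s _ _ s0 sp _ w1x).
apply: (@le_trans _ _ ((r `^ (- (n.+1%:R / s)))%:E *
    (F `^ p^-1 * (V' `^ ((1 - (p / s)^-1) * s^-1))%:E))).
  apply: lee_wpmul2l; first by rewrite lee_fin powR_ge0.
  have -> : F `^ p^-1 = F `^ ((p / s)^-1 * s^-1).
    by congr (_ `^ _); field; rewrite !gt_eqF.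
  rewrite -[X in _ <= _ * X]poweR_EFin (poweRrM F) (poweRrM V'%:E).
  rewrite -(poweRM _ (poweR_ge0 _ _) (poweR_ge0 _ _)).
  apply: gt0_ler_poweR phi.
  - by rewrite invr_ge0 ltW.
  - rewrite in_itv/= leey andbT; apply: integral_ge0 => x _.
    by rewrite lee_fin powR_ge0.
  - rewrite in_itv/= leey andbT; apply: mule_ge0; first exact: poweR_ge0.
    by rewrite lee_fin powR_ge0.
rewrite wLnormE -/B -/F [leLHS]muleCA [leRHS]muleCA.
apply: lee_wpmul2l; first exact: poweR_ge0.
rewrite omE poweR_EFin -!EFinM lee_fin [in leRHS]powRN.
rewrite ler_pdivlMr; last exact: powR_gt0.
rewrite -mulrA.
apply: le_trans (ler_wpM2l (powR_ge0 _ _) key) _.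
rewrite mulrCA; apply: ler_wpM2l; first exact: powR_ge0.
rewrite -(powR_ball_volume n.+1 r s r0).
apply: ler_wpM2l; first exact: powR_ge0.
have bn := ltW (lt_le_trans b0 br); apply: ge0_ler_powR br.
- by rewrite invr_ge0 ltW.
- by rewrite nnegrE ltW.
- exact: bn.
Qed.

(** Here [|f|] is at most [|f| * w1] times the essential supremum of [1/w1] on
    the ball, almost everywhere. *)
Lemma Muckenhoupt_local_average_bound_1 w1 w2 : weight w1 -> weight w2 ->
  Muckenhoupt 1 w1 w2 ->
  exists2 C : R, (0 < C)%R & forall (f : E -> R) a r,
    measurable_fun [set: E] f -> (0 < r)%R ->
    (r ^- n.+1)%:E * \int[mu]_(y in eball a r) `|f y|%:E <=
    C%:E * (\int[mu]_(x in eball a r) (`|f x| * w1 x)%:E *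
            (wmeasure w2 (eball a r))^-1).
Proof.
move=> hw1 hw2 [K K0 AK]; exists (K * 2 ^+ n.+1)%R.
  by rewrite mulr_gt0// exprn_gt0.
move=> f a r mf r0; set B := eball a r.
have mB : measurable B := measurable_eball a r.
have [b /andP[b0 br] bE] := lebesgue_eball_fin a r r0.
have [om om0 omE] := wmeasure_eball_fin w2 a r hw2 r0.
have := AK a r r0; rewrite -/B eqxx /average bE inver gt_eqF//.
rewrite -[\int[mu]_(x in B) _]/(wmeasure w2 B) omE.
have muT : 0 < mu [set: E].
  by apply: lt_le_trans (lebesgue_eball_gt0 a r r0) _; exact: le_lebesgue_outer.
have [mw1 w10 w1gt0 _] := hw1.
set g := fun x : E => ((w1 x)^-1 * \1_B x)%:E.
have ge := ess_sup_ge mu (abse \o g).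
have N0 : 0 <= 'N[mu]_+oo[g] := Lnorm_ge0 mu +oo g.
have NE : 'N[mu]_+oo[g] = ess_sup mu (abse \o g) by rewrite unlock muT.
rewrite -NE in ge; move: ('N[mu]_+oo[g]) N0 ge => {NE} N N0 ge AB.
have N_lty : N < +oo.
  rewrite ltey; apply/eqP => Noo; move: AB; rewrite Noo gt0_muley//.
  by rewrite -EFinM lte_fin mulr_gt0// invr_gt0.
case: N N0 N_lty ge AB => // N N0 _ ge; rewrite -!EFinM lee_fin => AB.
have mnf : measurable_fun [set: E] (fun x => `|f x|)%R by exact: measurableT_comp.
have mfw : measurable_fun [set: E] (fun x => `|f x| * w1 x)%R.
  exact: measurable_funM mnf mw1.
have le1 : \int[mu]_(y in B) `|f y|%:E <=
    N%:E * \int[mu]_(x in B) (`|f x| * w1 x)%:E.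
  rewrite -ge0_integralZl//; last 2 first.
  - by apply/measurable_EFinP/measurable_funTS.
  - by move=> x _; rewrite lee_fin mulr_ge0.
  apply: ae_ge0_le_integral; first exact: mB.
  - by move=> x _.
  - by apply/measurable_EFinP/measurable_funTS; exact: mnf.
  - by move=> x _; rewrite mule_ge0// lee_fin mulr_ge0.
  - apply: measurable_funeM; apply/measurable_EFinP/measurable_funTS; exact: mfw.
  - apply: filterS2 ge w1gt0 => x gx w1x Bx; rewrite -EFinM lee_fin.
    move: gx; rewrite /g/= indicE mem_set// mulr1 lee_fin ger0_norm ?invr_ge0//.
    rewrite -div1r ler_pdivrMr// => Nw; rewrite mulrCA mulrC.
    by rewrite -[leLHS]mul1r ler_wpM2r.
apply: (@le_trans _ _ ((r ^- n.+1)%:E *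
    (N%:E * \int[mu]_(x in B) (`|f x| * w1 x)%:E))).
  by apply: lee_wpmul2l => //; rewrite lee_fin invr_ge0 exprn_ge0// ltW.
rewrite inver (gt_eqF om0) muleA -EFinM [leRHS]muleCA muleC.
apply: lee_wpmul2l.
  by apply: integral_ge0 => x _; rewrite lee_fin mulr_ge0.
rewrite -EFinM lee_fin (ler_pdivlMr _ _ om0).
rewrite -mulrA (ler_pdivrMl _ _ (exprn_gt0 _ r0)).
have rE : (r ^+ n.+1 * (K * 2 ^+ n.+1) = (r *+ 2) ^+ n.+1 * K)%R.
  by rewrite -[(r *+ 2)%R]mulr_natr exprMn; ring.
rewrite rE; move: AB; rewrite -mulrA (ler_pdivrMl _ _ b0) [(om * N)%R]mulrC.
by move=> /le_trans; apply; rewrite (ler_pM2r K0).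
Qed.

Lemma Muckenhoupt_local_average_bound p s w1 w2 : (1 <= p)%R ->
  ((1 < p)%R -> (1 <= s < p)%R) -> (p = 1 -> s = 1)%R ->
  weight w1 -> weight w2 ->
  Muckenhoupt (p / s) (fun x => (w1 x `^ s)%R) (fun x => (w2 x `^ s)%R) ->
  exists2 C : R, (0 < C)%R & local_average_bound p s w1 w2 C.
Proof.
rewrite le_eqVlt => /predU1P[<-|p1] hs hs1 hw1 hw2 AK; last first.
  exact: (Muckenhoupt_local_average_bound_gt1 p s w1 w2 p1 (hs p1)).
move: AK; rewrite hs1// divr1.
have pow1 w : weight w -> (fun x => (w x `^ 1)%R) = w.
  by case=> _ w0 _ _; apply/funext => x; rewrite powRr1.
rewrite !pow1// => AK.
have [C C0 hC] := Muckenhoupt_local_average_bound_1 w1 w2 hw1 hw2 AK.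
exists C => // f a r mf r0; have := hC f a r mf r0.
have [om om0 omE] := wmeasure_eball_fin w2 a r hw2 r0.
rewrite omE inver (gt_eqF om0).
have [_ w10 _ _] := hw1.
rewrite wLnormE divr1 invr1 poweR_EFin !powRN.
rewrite (powR_mulrn _ (ltW r0)) (powRr1 (ltW om0)) !poweRe1; last 2 first.
- by apply: integral_ge0 => x _; rewrite lee_fin mulr_ge0 ?powR_ge0.
- by apply: integral_ge0 => x _; rewrite lee_fin powR_ge0.
have -> : \int[mu]_(y in eball a r) (`|f y| `^ 1)%:E =
    \int[mu]_(y in eball a r) `|f y|%:E.
  by apply: eq_integral => x _; rewrite powRr1.
have -> // : \int[mu]_(y in eball a r) (`|f y| `^ 1 * w1 y)%:E =
    \int[mu]_(y in eball a r) (`|f y| * w1 y)%:E.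
by apply: eq_integral => x _; rewrite powRr1.
Qed.

(** Apply the bound on [B(a,2r)] to the indicator function of [B(a,r)]: its
    [L^{p,w}] norm is [w(B(a,r))^(1/p)], and its normalised [L^s] norm is bounded
    below by a constant because the two balls have comparable volumes. *)
Lemma local_average_bound_doubling p s w C : (0 < s)%R -> (0 < p)%R ->
  weight w -> (0 < C)%R -> local_average_bound p s w w C ->
  exists2 C' : R, (0 < C')%R & forall a r, (0 < r)%R ->
    wmeasure w (eball a (2 * r)%R) `^ p^-1 <=
    C'%:E * wmeasure w (eball a r) `^ p^-1.
Proof.
move=> s0 p0 hw C0 hC.
exists (C * ((n.+2%:R ^+ n.+1) `^ s^-1))%R.
  by rewrite mulr_gt0// powR_gt0// exprn_gt0.
move=> a r r0; have r20 : (0 < 2 * r)%R by rewrite mulr_gt0.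
have [v v0 vE] := wmeasure_eball_fin w a r hw r0.
have [v2 v20 v2E] := wmeasure_eball_fin w a (2 * r)%R hw r20.
have mB : measurable (eball a r) := measurable_eball a r.
have mI : measurable_fun [set: E] (\1_(eball a r) : E -> R).
  exact: measurable_indic.
have BB : eball a r `<=` eball a (2 * r)%R.
  by apply: le_eball; rewrite ler_peMl ?ltW// ltr1n.
have := hC _ a (2 * r)%R mI r20.
have -> : \int[mu]_(y in eball a (2 * r)%R) (`|\1_(eball a r) y : R| `^ s)%:E =
    mu (eball a r).
  transitivity (\int[mu]_(y in eball a (2 * r)%R) (\1_(eball a r) y : R)%:E).
    apply: eq_integral => x _; rewrite indicE.
    by case: (_ \in _); rewrite ?normr1 ?powR1// normr0 powR0// gt_eqF.
  rewrite integral_indic//; last exact: measurable_eball.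
  by rewrite setIidl.
have -> : wLnorm p w (eball a (2 * r)%R) (EFin \o \1_(eball a r)) =
    wmeasure w (eball a r) `^ p^-1.
  rewrite wLnormE; congr (_ `^ _); rewrite [RHS](_ : _ =
    \int[mu]_(x in eball a (2 * r)%R `&` eball a r) (w x)%:E); last first.
    by rewrite setIidr.
  rewrite integral_mkcondr; apply: eq_integral => x _; rewrite patchE indicE.
  case: (_ \in _); rewrite ?normr1 ?powR1 ?mul1r// normr0 powR0 ?mul0r// gt_eqF//.
have [b /andP[b0 _] bE] := lebesgue_eball_fin a r r0.
have := lebesgue_eball_ge a r r0.
rewrite bE vE v2E !poweR_EFin -!EFinM !lee_fin => bge.
rewrite [in leRHS]powRN mulrA ler_pdivlMr ?powR_gt0// => h.
have x0 : (0 < (2 * r) ^+ n.+1)%R by rewrite exprn_gt0.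
have k0 : (0 < n.+2%:R ^+ n.+1 :> R)%R by rewrite exprn_gt0.
have hx : (((n.+2%:R ^+ n.+1) `^ s^-1)^-1 <=
    (2 * r) `^ (- (n.+1%:R / s)) * b `^ s^-1)%R.
  rewrite powRN powRrM (powR_mulrn _ (ltW r20)) ler_pdivlMl ?powR_gt0//.
  rewrite ler_pdivrMr ?powR_gt0// -(powRM _ (ltW b0) (ltW k0)).
  apply: ge0_ler_powR; rewrite ?nnegrE.
  - by rewrite invr_ge0 ltW.
  - exact: ltW.
  - by apply: mulr_ge0; exact: ltW.
  rewrite -ler_pdivrMr// -expr_div_n; apply: le_trans bge.
  by rewrite -[(r / _ *+ 2)%R]mulr_natl mulrA.
rewrite mulrAC mulrC -ler_pdivrMl ?powR_gt0//.
by apply: le_trans h; rewrite ler_wpM2r// powR_ge0.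
Qed.

End muckenhoupt.

(** * Dyadic sums and the condition on the pair of functions *)

Section dyadic.
Context {R : realType}.
Local Open Scope ereal_scope.

Let dyadic_itv (r : R) (k : nat) : set R :=
  `](2 ^+ k.+1 * r)%R, (2 ^+ k.+2 * r)%R]%classic.

(** The function [F] lies above the step function that is
    [c k / (2^(k+1) r)] on the [k]-th dyadic interval, whose length is
    [2^(k+1) r]. *)
Lemma dyadic_sum_le_integral (r : R) (F : R -> \bar R) (c : nat -> \bar R) :
  (0 < r)%R -> (forall k, 0 <= c k) -> (forall t, (r < t)%R -> 0 <= F t) ->
  (forall k t, (2 ^+ k.+1 * r < t)%R -> (t <= 2 ^+ k.+2 * r)%R ->
    (2 ^+ k.+1 * r)^-1%:E * c k <= F t) ->
  \sum_(k <oo) c k <= \int[lebesgue_measure]_(t in `]r, +oo[) F t.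
Proof.
move=> r0 c0 F0 cF.
have R0 k : (0 < 2 ^+ k * r)%R by rewrite mulr_gt0// exprn_gt0.
have Rmono j k : (j <= k)%N -> (2 ^+ j * r <= 2 ^+ k * r)%R.
  by move=> jk; rewrite ler_pM2r// ler_weXn2l// ler1n.
have mI k : measurable (dyadic_itv r k) by exact: measurable_itv.
pose step k t := (2 ^+ k.+1 * r)^-1%:E * c k * (\1_(dyadic_itv r k) t : R)%:E.
have step0 k t : 0 <= step k t.
  by rewrite /step !mule_ge0// lee_fin// invr_ge0 ltW.
have mD : measurable (`]r, +oo[%classic : set R) by exact: measurable_itv.
have subI k : dyadic_itv r k `<=` `]r, +oo[%classic.
  move=> t; rewrite /dyadic_itv/= !in_itv/= andbT => /andP[+ _].
  apply: le_lt_trans; rewrite -[leLHS]mul1r -(expr0 2); exact: Rmono.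
have -> : \sum_(k <oo) c k =
    \int[lebesgue_measure]_(t in `]r, +oo[) \sum_(k <oo) step k t.
  rewrite integral_nneseries//; last first.
    move=> k; apply: measurable_funeM; apply/measurable_EFinP.
    by apply: measurable_indic; exact: mI.
  apply: eq_eseriesr => k _.
  rewrite ge0_integralZl//; last 2 first.
  - by apply/measurable_EFinP; apply: measurable_indic; exact: mI.
  - by rewrite mule_ge0// lee_fin invr_ge0 ltW.
  have -> : \int[lebesgue_measure]_(x in `]r, +oo[) (\1_(dyadic_itv r k) x : R)%:E =
      (2 ^+ k.+1 * r)%:E.
    rewrite integral_indic; [|exact: mD|exact: mI].
    transitivity (lebesgue_measure (dyadic_itv r k)).
      by congr (lebesgue_measure _); apply: setIidl; exact: subI.
    rewrite lebesgue_measure_itv/= lte_fin ltr_pM2r// ltr_eXn2l ?ltr1n// ltnSn.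
    by rewrite -EFinB -mulrBl [in X in (X - _)%R]exprS mulr_natl mulr2n addrK.
  by rewrite muleAC -EFinM mulVf ?mul1e// gt_eqF.
apply: ge0_le_integral_nonmeasurable => //.
- by move=> t; exact: nneseries_ge0.
- by move=> t /=; rewrite in_itv/= andbT; exact: F0.
move=> t /=; rewrite in_itv/= andbT => rt.
have [[k tk]|no] := pselect (exists k, dyadic_itv r k t); last first.
  rewrite eseries0 ?F0// => k _ _; rewrite /step indicE memNset ?mule0// => tk.
  by apply: no; exists k.
rewrite (nneseriesD1 (n := k))// eseries0 ?adde0.
  rewrite /step indicE mem_set// mule1.
  by move: tk; rewrite /dyadic_itv/= in_itv/= => /andP[? ?]; exact: cF.
move=> j _ /= jk; rewrite /step indicE memNset ?mule0// => tj.
move: tk tj; rewrite /dyadic_itv/= !in_itv/= => /andP[k1 k2] /andP[j1 j2].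
have [kj|jk'|kj] := ltngtP k j; last by rewrite kj eqxx in jk.
  have kj1 : (k.+2 <= j.+1)%N by [].
  by have := lt_le_trans (le_lt_trans (Rmono _ _ kj1) j1) k2; rewrite ltxx.
have jk1 : (j.+2 <= k.+1)%N by [].
by have := lt_le_trans (le_lt_trans (Rmono _ _ jk1) k1) j2; rewrite ltxx.
Qed.

End dyadic.

Section morrey_dyadic_sum.
Context {R : realType} {n : nat}.
Local Notation E := (rvec R n).
Local Notation mu := (@lebesgue R n).
Implicit Types (a : E) (r p s : R) (w : E -> R) (f : E -> \bar R).
Local Open Scope ereal_scope.

Lemma wLnorm_ge0 p w A f : 0 <= wLnorm p w A f.
Proof. exact: poweR_ge0. Qed.

Lemma wLnorm_subset p w (A B : set E) f : (0 < p)%R -> (forall x, 0 <= w x)%R ->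
  A `<=` B -> wLnorm p w A f <= wLnorm p w B f.
Proof.
move=> p0 w0 AB.
have fw0 x : 0 <= `|f x| `^ p * (w x)%:E.
  by apply: mule_ge0; [exact: poweR_ge0|rewrite lee_fin].
apply: gt0_ler_poweR.
- by rewrite invr_ge0 ltW.
- by rewrite in_itv/= leey andbT; apply: integral_ge0.
- by rewrite in_itv/= leey andbT; apply: integral_ge0.
- exact: ge0_le_integral_nonmeasurable.
Qed.

Lemma wmeasure_subset w (A B : set E) : (forall x, 0 <= w x)%R ->
  A `<=` B -> wmeasure w A <= wmeasure w B.
Proof.
by move=> w0 AB; apply: ge0_le_integral_nonmeasurable => // x; rewrite lee_fin.
Qed.

Lemma wmeasure_eball_root w p a r : (0 < p)%R -> weight w -> (0 < r)%R ->
  exists2 v : R, (0 < v)%R & wmeasure w (eball a r) `^ p^-1 = v%:E /\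
    wmeasure w (eball a r) `^ (- p^-1) = v^-1%:E.
Proof.
move=> p0 hw r0; have [v v0 ->] := wmeasure_eball_fin w a r hw r0.
by exists (v `^ p^-1)%R; rewrite ?powR_gt0// !poweR_EFin powRN.
Qed.

Variables (p : R) (w1 w2 : E -> R) (psi1 psi2 : E -> R -> R).
Hypotheses (p0 : (0 < p)%R) (hw1 : weight w1) (hw2 : weight w2).
Hypothesis psi1_gt0 : forall a r, (0 < r)%R -> (0 < psi1 a r)%R.
Hypothesis psi2_gt0 : forall a r, (0 < r)%R -> (0 < psi2 a r)%R.

(** The numerator of the integrand of [psi_condition]. *)
Definition tail_inf a t : \bar R :=
  ereal_inf [set (psi1 a l)%:E * wmeasure w1 (eball a l) `^ p^-1 |
            l in `[t, +oo[].

Lemma tail_inf_ge0 a t : (0 < t)%R -> 0 <= tail_inf a t.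
Proof.
move=> t0; apply: le_ereal_inf_tmp => y [l /=]; rewrite in_itv/= andbT => tl <-{y}.
apply: mule_ge0; last exact: poweR_ge0.
by rewrite lee_fin ltW// psi1_gt0// (lt_le_trans t0).
Qed.

Lemma le_tail_inf a t t' : (t <= t')%R -> tail_inf a t <= tail_inf a t'.
Proof.
move=> tt'; apply: ereal_inf_le_tmp => _ [l tl <-]; exists l => //.
by move: tl; rewrite /= !in_itv/= !andbT; exact: le_trans.
Qed.

Lemma morrey_norm_ge0 f : 0 <= morrey_norm p w1 psi1 f.
Proof.
apply: le_ereal_sup_tmp; exists ((psi1 0%R 1%R)^-1%:E *
  wmeasure w1 (eball 0%R 1%R) `^ (- p^-1) * wLnorm p w1 (eball 0%R 1%R) f).
  by exists 0%R => //; exists 1%R => /=.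
apply: mule_ge0; last exact: wLnorm_ge0.
by apply: mule_ge0; [rewrite lee_fin invr_ge0 ltW// psi1_gt0|exact: poweR_ge0].
Qed.

Lemma wLnorm_le_morrey f a r : (0 < r)%R ->
  wLnorm p w1 (eball a r) f <= morrey_norm p w1 psi1 f *
    ((psi1 a r)%:E * wmeasure w1 (eball a r) `^ p^-1).
Proof.
move=> r0; have [v v0 [vE vNE]] := wmeasure_eball_root w1 p a r p0 hw1 r0.
have ps0 := psi1_gt0 a r r0.
have : (psi1 a r)^-1%:E * wmeasure w1 (eball a r) `^ (- p^-1) *
    wLnorm p w1 (eball a r) f <= morrey_norm p w1 psi1 f.
  by apply: ereal_sup_ubound; exists a => //; exists r.
rewrite vE vNE -EFinM -invfM.
by rewrite lee_pdivrMl ?mulr_gt0// -EFinM muleC.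
Qed.

(** The norm on [B(a,t)] is at most the norm on [B(a,l)] for every [l >= t], and
    each of the latter is bounded through the Morrey norm. *)
Lemma wLnorm_le_tail_inf f a t : (0 < t)%R -> morrey_norm p w1 psi1 f < +oo ->
  wLnorm p w1 (eball a t) f <= morrey_norm p w1 psi1 f * tail_inf a t.
Proof.
move=> t0; have M0 := morrey_norm_ge0 f.
have hL l : (t <= l)%R -> wLnorm p w1 (eball a t) f <=
    morrey_norm p w1 psi1 f * ((psi1 a l)%:E * wmeasure w1 (eball a l) `^ p^-1).
  move=> tl; apply: le_trans (wLnorm_le_morrey _ _ _ (lt_le_trans t0 tl)).
  by apply: wLnorm_subset => //; [case: hw1|exact: le_eball].
move: (morrey_norm _ _ _ _) M0 hL => [m||]// M0 hL _.
move: M0; rewrite lee_fin le_eqVlt => /predU1P[m0|m0].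
  (* dividing by the Morrey norm, as done below, requires that it be nonzero *)
  by rewrite -m0 mul0e; have := hL t (lexx _); rewrite -m0 mul0e.
rewrite -lee_pdivrMl//; apply: le_ereal_inf_tmp => y [l /=].
rewrite in_itv/= andbT => tl <-{y}.
by rewrite lee_pdivrMl//; exact: hL.
Qed.

(** On the dyadic interval above [2^(k+1) r] the infimum has only increased,
    [1/t] has decreased by at most a factor 2, and [w2(B(a,t))^(1/p)] has grown
    by at most the doubling constant [Cd].  So the sum is at most [2 * Cd] times
    the integral. *)
Lemma morrey_dyadic_sum (Cd : R) : (0 < Cd)%R ->
  (forall a r, (0 < r)%R -> wmeasure w2 (eball a (2 * r)%R) `^ p^-1 <=
    Cd%:E * wmeasure w2 (eball a r) `^ p^-1) ->
  psi_condition p w1 w2 psi1 psi2 ->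
  exists2 C : R, (0 < C)%R & forall f a r, (0 < r)%R ->
    morrey_norm p w1 psi1 f < +oo ->
    (psi2 a r)^-1%:E * \sum_(k <oo)
      (wLnorm p w1 (eball a (2 ^+ k.+1 * r)%R) f *
       wmeasure w2 (eball a (2 ^+ k.+1 * r)%R) `^ (- p^-1)) <=
    C%:E * morrey_norm p w1 psi1 f.
Proof.
move=> Cd0 hCd; rewrite /psi_condition.
set Sup := ereal_sup _ => Sup_lty.
have [K K0 hK] : exists2 K : R, (0 < K)%R & Sup <= K%:E.
  case: Sup Sup_lty => [k||]// _; last by exists 1%R => //; rewrite leNye.
  by exists (Num.max 1 k)%R; rewrite ?lt_max ?ltr01// lee_fin le_max lexx orbT.
exists (2 * Cd * K)%R; first by rewrite !mulr_gt0.
move=> f a r r0 M_lty; have M0 := morrey_norm_ge0 f.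
have R0 k : (0 < 2 ^+ k * r)%R by rewrite mulr_gt0// exprn_gt0.
pose c k := tail_inf a (2 ^+ k.+1 * r)%R *
  wmeasure w2 (eball a (2 ^+ k.+1 * r)%R) `^ (- p^-1).
have c0 k : 0 <= c k.
  by apply: mule_ge0; [exact: tail_inf_ge0|exact: poweR_ge0].
pose F t := tail_inf a t / wmeasure w2 (eball a t) `^ p^-1 * t^-1%:E.
have F0 t : (r < t)%R -> 0 <= F t.
  move=> rt; have t0 := lt_trans r0 rt.
  apply: mule_ge0; last by rewrite lee_fin invr_ge0 ltW.
  by apply: mule_ge0; [exact: tail_inf_ge0|rewrite inve_ge0 poweR_ge0].
have sumF : \sum_(k <oo) ((2 * Cd)^-1%:E * c k) <=
    \int[lebesgue_measure]_(t in `]r, +oo[) F t.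
  apply: dyadic_sum_le_integral => // [k|k t kt tk].
    by apply: mule_ge0 => //; rewrite lee_fin invr_ge0 mulr_ge0// ltW.
  have t0 := lt_trans (R0 k.+1) kt.
  have [v v0 [vE vNE]] := wmeasure_eball_root w2 p a _ p0 hw2 (R0 k.+1).
  have [u u0 [uE _]] := wmeasure_eball_root w2 p a t p0 hw2 t0.
  have uv : (u <= Cd * v)%R.
    rewrite -lee_fin EFinM -uE -vE; apply: le_trans (hCd a _ (R0 k.+1)).
    apply: gt0_ler_poweR.
    - by rewrite invr_ge0 ltW.
    - by rewrite in_itv/= leey andbT ltW// wmeasure_eball_gt0.
    - by rewrite in_itv/= leey andbT ltW// wmeasure_eball_gt0// mulr_gt0.
    - apply: wmeasure_subset; first by case: hw2.
      by apply: le_eball; rewrite mulrA -exprS.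
  rewrite /c /F vNE uE inver (gt_eqF u0) muleCA muleC -!muleA.
  rewrite [leLHS]muleCA.
  apply: (@le_trans _ _ (tail_inf a (2 ^+ k.+1 * r)%R * (u^-1%:E * t^-1%:E))).
    apply: lee_wpmul2l; first exact: tail_inf_ge0.
    rewrite -!EFinM lee_fin -!invfM lef_pV2 ?posrE ?mulr_gt0//.
    apply: (@le_trans _ _ ((Cd * v) * (2 * (2 ^+ k.+1 * r)))%R).
      by apply: ler_pM; [exact: ltW|exact: ltW|exact: uv|rewrite mulrA -exprS].
    by rewrite le_eqVlt; apply/orP; left; apply/eqP; ring.
  apply: lee_wpmul2r; last by apply: le_tail_inf; exact: ltW.
  by rewrite -EFinM lee_fin -invfM invr_ge0 mulr_ge0// ltW.
have psiK : (psi2 a r)^-1%:E * \int[lebesgue_measure]_(t in `]r, +oo[) F t <= K%:E.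
  by apply: le_trans hK; apply: ereal_sup_ubound; exists a => //; exists r.
have ps0 : 0 <= (psi2 a r)^-1%:E by rewrite lee_fin invr_ge0 ltW// psi2_gt0.
have [m m0 mE] : exists2 m : R, (0 <= m)%R & morrey_norm p w1 psi1 f = m%:E.
  by case: (morrey_norm _ _ _ _) M0 M_lty => // m m0 _; exists m.
apply: (@le_trans _ _ ((psi2 a r)^-1%:E * (m%:E * \sum_(k <oo) c k))).
  apply: lee_wpmul2l => //; rewrite -nneseriesZl//.
  apply: lee_nneseries => [k _ _|k _].
    by apply: mule_ge0; [exact: wLnorm_ge0|exact: poweR_ge0].
  rewrite /c muleA; apply: lee_wpmul2r; first exact: poweR_ge0.
  by rewrite -mE; exact: wLnorm_le_tail_inf.
rewrite mE muleCA [leRHS]muleC; apply: lee_wpmul2l; first by rewrite lee_fin.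
rewrite EFinM -lee_pdivrMl ?mulr_gt0//; apply: le_trans psiK.
rewrite muleCA; apply: lee_wpmul2l => //.
by rewrite -nneseriesZl.
Qed.

End morrey_dyadic_sum.

(** * Splitting of the operator on a ball *)

Section splitting.
Context {R : realType} {n : nat}.
Local Notation E := (rvec R n).
Local Notation mu := (@lebesgue R n).
Implicit Types (a : E) (r p s : R) (w : E -> R).
Local Open Scope ereal_scope.

Lemma poweRD_le (x y : \bar R) (t : R) : (0 <= t)%R -> 0 <= x -> 0 <= y ->
  (x + y) `^ t <= (2 `^ t)%:E * (x `^ t + y `^ t).
Proof.
move=> t0.
wlog xy : x y / x <= y => [hw x0 y0|x0 y0].
  have [xy|/ltW yx] := leP x y; first exact: hw.
  by rewrite addeC [X in _ * X]addeC; exact: hw.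
apply: (@le_trans _ _ ((2%:E * y) `^ t)).
  apply: gt0_ler_poweR => //.
  - by rewrite in_itv/= leey andbT adde_ge0.
  - by rewrite in_itv/= leey andbT mule_ge0.
  - by rewrite (_ : 2%:E * y = y + y) ?leeD2r// muleC mule_natr mule2n.
rewrite poweRM// poweR_EFin; apply: lee_wpmul2l; first by rewrite lee_fin powR_ge0.
by rewrite leeDr// poweR_ge0.
Qed.

Variables (p : R) (w : E -> R) (B : set E) (g g1 : E -> \bar R) (T : \bar R).
Hypotheses (p1 : (1 <= p)%R) (hw : weight w) (mB : measurable B).
Hypotheses (mg : measurable_fun [set: E] g) (mg1 : measurable_fun [set: E] g1).
Hypothesis T0 : 0 <= T.
Hypothesis g_le : {ae mu, forall x, B x -> `|g x| <= `|g1 x| + T}.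

(** A crude triangle inequality that also holds for infinite values: powers of a
    sum are bounded by sums of powers, once for the exponent [p] and once for
    [1/p], and [4] bounds the resulting constant [2 * 2^(1/p)]. *)
Lemma wLnorm_split : wLnorm p w B g <=
  4%:E * (wLnorm p w [set: E] g1 + T * wmeasure w B `^ p^-1).
Proof.
have [mw w0 _ _] := hw; have p0 : (0 < p)%R := lt_le_trans ltr01 p1.
have mpow (h : E -> \bar R) : measurable_fun [set: E] h ->
    measurable_fun [set: E] (fun x => `|h x| `^ p * (w x)%:E).
  move=> mh; apply: emeasurable_funM; last by apply/measurable_EFinP.
  apply: (measurableT_comp (measurable_poweR p)).
  exact: measurableT_comp.
have wE0 x : 0 <= (w x)%:E by rewrite lee_fin.
have pow0 (h : E -> \bar R) x : 0 <= `|h x| `^ p * (w x)%:E.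
  by apply: mule_ge0 => //; exact: poweR_ge0.
set U := \int[mu]_(x in B) (`|g1 x| `^ p * (w x)%:E).
have U0 : 0 <= U by apply: integral_ge0.
have V0 : 0 <= T `^ p * wmeasure w B.
  by apply: mule_ge0; [exact: poweR_ge0|exact: integral_ge0].
have int_le : \int[mu]_(x in B) (`|g x| `^ p * (w x)%:E) <=
    (2 `^ p)%:E * (U + T `^ p * wmeasure w B).
  have mwB : measurable_fun B (fun x => (w x)%:E).
    by apply/measurable_EFinP; exact: measurable_funTS.
  rewrite /wmeasure -ge0_integralZl;
    [|exact: mB|exact: mwB|by move=> x _; exact: wE0|exact: poweR_ge0].
  rewrite -ge0_integralD; [|exact: mB|by move=> x _; exact: pow0
    |by apply: measurable_funTS; exact: mpow
    |by move=> x _; apply: mule_ge0; [exact: poweR_ge0|exact: wE0]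
    |exact: measurable_funeM].
  have mD : measurable_fun B (fun x => `|g1 x| `^ p * (w x)%:E + T `^ p * (w x)%:E).
    apply: emeasurable_funD; first by apply: measurable_funTS; exact: mpow.
    exact: measurable_funeM.
  have D0 x : 0 <= `|g1 x| `^ p * (w x)%:E + T `^ p * (w x)%:E.
    by rewrite adde_ge0// mule_ge0// poweR_ge0.
  rewrite -ge0_integralZl; [|exact: mB|exact: mD|by move=> x _; exact: D0
    |by rewrite lee_fin powR_ge0].
  apply: ae_ge0_le_integral; first exact: mB.
  - by [].
  - by apply: measurable_funTS; exact: mpow.
  - by move=> x _; apply: mule_ge0 => //; rewrite lee_fin powR_ge0.
  - exact: measurable_funeM.
  - apply: filterS g_le => x gx Bx; rewrite -ge0_muleDl ?poweR_ge0// muleA.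
    apply: lee_wpmul2r => //; apply: le_trans (poweRD_le _ _ _ _ _ _) => //.
      apply: gt0_ler_poweR (gx Bx); rewrite ?in_itv/= ?leey ?abse_ge0//.
        exact: ltW.
      by rewrite adde_ge0.
    exact: ltW.
apply: (@le_trans _ _ (((2 `^ p)%:E * (U + T `^ p * wmeasure w B)) `^ p^-1)).
  apply: gt0_ler_poweR int_le; rewrite ?in_itv/= ?leey ?andbT.
  - by rewrite invr_ge0 ltW.
  - exact: integral_ge0.
  - by apply: mule_ge0; [rewrite lee_fin powR_ge0|exact: adde_ge0].
rewrite poweRM; [|by rewrite lee_fin powR_ge0|exact: adde_ge0].
rewrite poweR_EFin -powRrM divff ?gt_eqF//.
rewrite powRr1// (_ : 4%:E = 2%:E * 2%:E); last by rewrite -EFinM -natrM.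
rewrite -muleA; apply: lee_wpmul2l => //.
apply: le_trans (poweRD_le _ _ _ _ _ _) _ => //; first by rewrite invr_ge0 ltW.
apply: lee_pmul.
- by rewrite lee_fin powR_ge0.
- by rewrite adde_ge0// poweR_ge0.
- by rewrite lee_fin ler1_powR ?ler1n// invf_le1.
apply: leeD.
  apply: gt0_ler_poweR; rewrite ?in_itv/= ?leey ?andbT.
  - by rewrite invr_ge0 ltW.
  - exact: U0.
  - exact: integral_ge0.
  - exact: ge0_le_integral_nonmeasurable.
rewrite poweRM ?poweR_ge0//; last exact: integral_ge0.
by rewrite -poweRrM divff ?gt_eqF// poweRe1.
Qed.

(** At a level [c] with [c/2 < T] the superlevel set of [g] is estimated by the
    whole of [B]; at the other levels [|g| > c] forces [|g1| > c/2] almost everywhere on [B]. *)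
Lemma wWLnorm_split : wWLnorm p w B g <=
  4%:E * (wWLnorm p w [set: E] g1 + T * wmeasure w B `^ p^-1).
Proof.
have [mw w0 _ _] := hw; have p0 : (0 < p)%R := lt_le_trans ltr01 p1.
have ip0 : (0 <= p^-1)%R by rewrite invr_ge0 ltW.
have wm0 A : 0 <= wmeasure w A by apply: integral_ge0 => x _; rewrite lee_fin.
have WL0 : 0 <= wWLnorm p w [set: E] g1.
  apply: le_ereal_sup_tmp; eexists; first by exists 1%R; [exact: ltr01|].
  by apply: mule_ge0 => //; exact: poweR_ge0.
have TB0 : 0 <= T * wmeasure w B `^ p^-1 by apply: mule_ge0 => //; exact: poweR_ge0.
apply: (@le_trans _ _
  (2%:E * (wWLnorm p w [set: E] g1 + T * wmeasure w B `^ p^-1))); last first.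
  by apply: lee_wpmul2r; [exact: adde_ge0|rewrite lee_fin ler_nat].
apply: ge_ereal_sup => _ [c /= c0 <-].
have c20 : (0 < c / 2)%R by rewrite divr_gt0.
have cE : c%:E = 2%:E * (c / 2)%:E by rewrite -EFinM mulrCA divff ?mulr1.
rewrite [in X in X * _]cE -muleA; apply: lee_wpmul2l => //.
have [cT|Tc] := ltP (c / 2)%:E T.
  apply: (@le_trans _ _ (T * wmeasure w B `^ p^-1)); last by rewrite leeDr.
  apply: lee_pmul; [by rewrite lee_fin ltW|exact: poweR_ge0|exact: ltW|].
  apply: gt0_ler_poweR; rewrite ?in_itv/= ?leey ?andbT//.
  by apply: wmeasure_subset => // x [].
apply: (@le_trans _ _ (wWLnorm p w [set: E] g1)); last by rewrite leeDl.
apply: le_ereal_sup_tmp; eexists; first by exists (c / 2)%R.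
apply: lee_wpmul2l; first by rewrite lee_fin ltW.
apply: gt0_ler_poweR; rewrite ?in_itv/= ?leey ?andbT//.
have mlevel (h : E -> \bar R) k : measurable_fun [set: E] h ->
    measurable [set x | k%:E < `|h x|].
  move=> mh; rewrite -[X in measurable X]setTI.
  apply: emeasurable_fun_o_infty; first exact: measurableT.
  exact: measurableT_comp.
rewrite /wmeasure setTI integral_mkcond [leRHS]integral_mkcond.
have mrest A : measurable A -> measurable_fun [set: E] ((fun x => (w x)%:E) \_ A).
  move=> mA; apply/(measurable_restrictT _ mA).1.
  by apply/measurable_EFinP; exact: measurable_funTS.
apply: ae_ge0_le_integral; first exact: measurableT.
- by move=> x _; apply: erestrict_ge0 => y _; rewrite lee_fin.
- by apply: mrest; apply: measurableI => //; exact: mlevel.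
- by move=> x _; apply: erestrict_ge0 => y _; rewrite lee_fin.
- by apply: mrest; exact: mlevel.
- apply: filterS g_le => x gx _; rewrite !patchE.
  case: ifPn => [/set_mem[Bx cg]|_]; last by case: ifPn => // _; rewrite lee_fin.
  rewrite mem_set//=; rewrite ltNge; apply/negP => gc.
  move: cg; rewrite /= ltNge => /negP; apply.
  apply: le_trans (gx Bx) _; apply: le_trans (leeD gc Tc) _.
  by rewrite -EFinD lee_fin -splitr.
Qed.

End splitting.

Section localisation.
Context {R : realType} {n : nat}.
Local Notation E := (rvec R n).
Local Notation mu := (@lebesgue R n).
Implicit Types (a : E) (r : R).
Local Open Scope ereal_scope.

Variables (p s : R) (w1 w2 : E -> R) (psi1 psi2 : E -> R -> R).
Variables (D : set (E -> R)) (S : (E -> R) -> E -> \bar R).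
Variable NB : set E -> (E -> \bar R) -> \bar R.
Hypotheses (p1 : (1 <= p)%R) (hs : (1 < p)%R -> (1 <= s < p)%R).
Hypotheses (hs1 : p = 1%R -> s = 1%R) (hw1 : weight w1) (hw2 : weight w2).
Hypothesis hw12 :
  Muckenhoupt (p / s) (fun x => (w1 x `^ s)%R) (fun x => (w2 x `^ s)%R).
Hypothesis hw22 :
  Muckenhoupt (p / s) (fun x => (w2 x `^ s)%R) (fun x => (w2 x `^ s)%R).
Hypothesis psi1_gt0 : forall a r, (0 < r)%R -> (0 < psi1 a r)%R.
Hypothesis psi2_gt0 : forall a r, (0 < r)%R -> (0 < psi2 a r)%R.
Hypothesis hpsi : psi_condition p w1 w2 psi1 psi2.
Hypothesis hD : operator_domain D.
Hypothesis hDM : finite_norm_space (morrey_norm p w1 psi1) `<=` D.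
Hypothesis hS : sublinear D S.
Hypothesis hsize : size_condition s D S.
Hypothesis NB_split : forall (B : set E) (g g1 : E -> \bar R) (T : \bar R),
  measurable B -> measurable_fun [set: E] g -> measurable_fun [set: E] g1 ->
  0 <= T -> {ae mu, forall x, B x -> `|g x| <= `|g1 x| + T} ->
  NB B g <= 4%:E * (NB [set: E] g1 + T * wmeasure w2 B `^ p^-1).

(** The quasinorm [NB] stands for either of the two families of local norms, of
    which only the splitting inequality matters.  The constant [T] is the bound
    that the size condition gives for the part of [f] away from [B(a,2r)]. *)
Lemma local_bound : bounded_operator (wLnorm p w1 [set: E]) (NB [set: E]) S ->
  exists2 C : R, (0 < C)%R & forall f : E -> R,
    finite_norm_space (morrey_norm p w1 psi1) f -> forall a r, (0 < r)%R ->
    (psi2 a r)^-1%:E * wmeasure w2 (eball a r) `^ (- p^-1) *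
      NB (eball a r) (S f) <= C%:E * morrey_norm p w1 psi1 (EFin \o f).
Proof.
move=> [C0 C00 hC0].
have p0 : (0 < p)%R := lt_le_trans ltr01 p1.
have s0 : (0 < s)%R.
  move: p1; rewrite le_eqVlt => /predU1P[/esym/hs1->//|/hs/andP[s1 _]].
  exact: lt_le_trans ltr01 s1.
have [C12 C120 hC12] :=
  Muckenhoupt_local_average_bound p s w1 w2 p1 hs hs1 hw1 hw2 hw12.
have [C22 C220 hC22] :=
  Muckenhoupt_local_average_bound p s w2 w2 p1 hs hs1 hw2 hw2 hw22.
have [Cd Cd0 hCd] := local_average_bound_doubling p s w2 C22 s0 p0 hw2 C220 hC22.
have [Cm Cm0 hCm] := morrey_dyadic_sum p w1 w2 psi1 psi2 p0 hw1 hw2 psi1_gt0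
  psi2_gt0 Cd Cd0 hCd hpsi.
have [Cs Cs0 hCs] := hsize.
have [mD D0 DD DZ DI] := hD; have [mS SD SZ] := hS.
exists (4 * (C0 * Cd + Cs * C12) * Cm)%R.
  by rewrite !mulr_gt0// addr_gt0// mulr_gt0.
move=> f ff a r r0; have [mf M_lty] := ff; have Df := hDM _ ff.
have r20 : (0 < 2 * r)%R by rewrite mulr_gt0.
have R0 k : (0 < 2 ^+ k * r)%R by rewrite mulr_gt0// exprn_gt0.
pose B k := eball a (2 ^+ k * r)%R.
pose f2 : E -> R := fun y => (f y * \1_(~` eball a (2 * r)%R) y)%R.
pose f1 : E -> R := fun y => (f y * \1_(eball a (2 * r)%R) y)%R.
have Df2 : D f2 by exact: DI.
have f1E : f1 = (f \+ (fun x => -1 * f2 x))%R.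
  apply/funext => x; rewrite /f1 /f2 /= !indicE in_setC.
  by case: (_ \in _); rewrite /= ?mulr1 ?mulr0 ?addr0// mulN1r ?oppr0 ?addr0 ?subrr.
have Df1 : D f1 by rewrite f1E; apply: DD => //; exact: DZ.
have fE : (f1 \+ f2)%R = f.
  apply/funext => x; rewrite /f1 /f2 /= !indicE in_setC.
  by case: (_ \in _); rewrite /= ?mulr1 ?mulr0 ?addr0 ?add0r.
pose L k := wLnorm p w1 (B k.+1) (EFin \o f) * wmeasure w2 (B k.+1) `^ (- p^-1).
have L0 k : 0 <= L k by apply: mule_ge0; [exact: wLnorm_ge0|exact: poweR_ge0].
have normf1 : wLnorm p w1 [set: E] (EFin \o f1) = wLnorm p w1 (B 1%N) (EFin \o f).
  rewrite /B expr1 /wLnorm [in RHS]integral_mkcond; congr (_ `^ _).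
  apply: eq_integral => x _; rewrite /= patchE /f1 indicE.
  case: (_ \in _); rewrite ?mulr1// mulr0 normr0 powR0 ?mul0e// gt_eqF//.
have f1_lty : wLnorm p w1 [set: E] (EFin \o f1) < +oo.
  rewrite normf1; apply: le_lt_trans (wLnorm_le_morrey p w1 psi1 p0 hw1 psi1_gt0
    _ a _ (R0 1%N)) _.
  have [v v0 [-> _]] := wmeasure_eball_root w1 p a _ p0 hw1 (R0 1%N).
  have M_fin : morrey_norm p w1 psi1 (EFin \o f) \is a fin_num.
    by rewrite ge0_fin_numE; [exact: M_lty|exact: morrey_norm_ge0].
  by rewrite -(fineK M_fin) -!EFinM ltry.
have S1 := hC0 f1 (conj (mD _ Df1) f1_lty).
pose T := Cs%:E * (C12%:E * \sum_(k <oo) L k).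
have sumL0 : 0 <= \sum_(k <oo) L k by exact: nneseries_ge0.
have T0 : 0 <= T.
  apply: mule_ge0; first by rewrite lee_fin; exact: ltW.
  by apply: mule_ge0; [rewrite lee_fin; exact: ltW|exact: sumL0].
have S2 x : eball a r x -> `|S f2 x| <= T.
  move=> xB; apply: (@le_trans _ _ (ereal_sup [set `|S f2 x| | x in eball a r])).
    by apply: ereal_sup_ubound; exists x.
  apply: le_trans (hCs f a r Df r0) _; apply: lee_wpmul2l.
    by rewrite lee_fin ltW.
  apply: (@le_trans _ _ (\sum_(1 <= k <oo) (C12%:E * L k))).
    apply: lee_nneseries => [k _ _|k _].
      by apply: mule_ge0; [rewrite lee_fin powR_ge0|exact: poweR_ge0].
    exact: hC12.
  rewrite nneseriesZl; last by move=> k _; exact: L0.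
  apply: lee_wpmul2l; first by rewrite lee_fin; exact: ltW.
  (* the size condition omits the index 0, which is needed for [f1] instead *)
  rewrite [leRHS](nneseries_split 0 1); last by move=> k _; exact: L0.
  by apply: leeDr; apply: sume_ge0 => k _; exact: L0.
have Sle : {ae mu, forall x, eball a r x -> `|S f x| <= `|S f1 x| + T}.
  have := SD f1 f2 Df1 Df2; rewrite fE; apply: filterS => x Sx xB.
  by apply: le_trans Sx _; apply: leeD2l; exact: S2.
have main := NB_split _ _ _ T (measurable_eball a r) (mS _ Df) (mS _ Df1) T0 Sle.
have [v v0 [vE vNE]] := wmeasure_eball_root w2 p a r p0 hw2 r0.
have [u u0 [uE uNE]] := wmeasure_eball_root w2 p a _ p0 hw2 (R0 1%N).
have uv : (u <= Cd * v)%R.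
  by rewrite -lee_fin EFinM -uE -vE expr1; exact: hCd.
have L1 : wLnorm p w1 (B 1%N) (EFin \o f) * u^-1%:E <= \sum_(k <oo) L k.
  rewrite -uNE; change (L 0%N <= \sum_(k <oo) L k).
  rewrite (nneseriesD1 (n := 0%N)); [|by move=> k _; exact: L0|by []].
  by apply: leeDl; apply: nneseries_ge0 => k _ _; exact: L0.
have psi20 : (0 < (psi2 a r)^-1)%R by rewrite invr_gt0 psi2_gt0.
have loc : v^-1%:E * NB (eball a r) (S f) <=
    (4 * (C0 * Cd + Cs * C12))%:E * \sum_(k <oo) L k.
  apply: (@le_trans _ _ (v^-1%:E * (4%:E *
      (C0%:E * wLnorm p w1 (B 1%N) (EFin \o f) + T * v%:E)))).
    apply: lee_wpmul2l; first by rewrite lee_fin invr_ge0 ltW.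
    apply: le_trans main _; apply: lee_wpmul2l; first by rewrite lee_fin.
    by rewrite vE -normf1; apply: leeD.
  rewrite [leLHS]muleCA EFinM -[leRHS]muleA.
  apply: lee_wpmul2l; first by rewrite lee_fin.
  rewrite ge0_muleDr; last 2 first.
  - by apply: mule_ge0; [rewrite lee_fin; exact: ltW|exact: wLnorm_ge0].
  - by apply: mule_ge0; [exact: T0|rewrite lee_fin; exact: ltW].
  rewrite EFinD [leRHS]ge0_muleDl; last 2 first.
  - by rewrite lee_fin; apply: mulr_ge0; exact: ltW.
  - by rewrite lee_fin; apply: mulr_ge0; exact: ltW.
  apply: leeD.
    rewrite [leLHS]muleCA EFinM -[leRHS]muleA.
    apply: lee_wpmul2l; first by rewrite lee_fin; exact: ltW.
    apply: (@le_trans _ _ (Cd%:E * (wLnorm p w1 (B 1%N) (EFin \o f) * u^-1%:E))).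
      rewrite [leLHS]muleC [leRHS]muleCA.
      apply: lee_wpmul2l; first exact: wLnorm_ge0.
      rewrite -EFinM lee_fin (ler_pdivlMr _ _ u0) mulrC (ler_pdivrMr _ _ v0).
      exact: uv.
    by apply: lee_wpmul2l; [rewrite lee_fin; exact: ltW|exact: L1].
  rewrite muleCA -EFinM mulVf; last by rewrite gt_eqF.
  by rewrite mule1 /T muleA EFinM.
rewrite vNE -muleA; move: loc; set K := (4 * _)%R => loc.
apply: (@le_trans _ _ ((psi2 a r)^-1%:E * (K%:E * \sum_(k <oo) L k))).
  by apply: lee_wpmul2l; [rewrite lee_fin; exact: ltW|exact: loc].
rewrite [leLHS]muleCA (EFinM K Cm) -[leRHS]muleA; apply: lee_wpmul2l.
  rewrite lee_fin; apply: mulr_ge0; first by [].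
  by apply: addr_ge0; apply: mulr_ge0; exact: ltW.
exact: hCm.
Qed.

End localisation.

Theorem theorem1p6 (R : realType) (n : nat) (p s : R)
    (hp : 1 <= p)
    (hs : 1 < p -> 1 <= s < p)
    (hs1 : p = 1 -> s = 1)
    (w1 w2 : rvec R n -> R)
    (hw1 : weight w1)
    (hw2 : weight w2)
    (hw12 : Muckenhoupt (p / s) (fun x => w1 x `^ s) (fun x => w2 x `^ s))
    (hw22 : Muckenhoupt (p / s) (fun x => w2 x `^ s) (fun x => w2 x `^ s))
    (psi1 psi2 : rvec R n -> R -> R)
    (hpsi1 : forall a r, 0 < r -> 0 < psi1 a r)
    (hpsi2 : forall a r, 0 < r -> 0 < psi2 a r)
    (hpsi : psi_condition p w1 w2 psi1 psi2)
    (D : set (rvec R n -> R))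
    (hD : operator_domain D)
    (hDL : finite_norm_space (wLnorm p w1 [set: rvec R n]) `<=` D)
    (hDM : finite_norm_space (morrey_norm p w1 psi1) `<=` D)
    (S : (rvec R n -> R) -> rvec R n -> \bar R)
    (hS : sublinear D S)
    (hsize : size_condition s D S) :
  (1 < p ->
   bounded_operator (wLnorm p w1 [set: rvec R n])
                    (wLnorm p w2 [set: rvec R n]) S ->
   bounded_operator (morrey_norm p w1 psi1) (morrey_norm p w2 psi2) S) /\
  (p = 1 ->
   bounded_operator (wLnorm 1 w1 [set: rvec R n])
                    (wWLnorm 1 w2 [set: rvec R n]) S ->
   bounded_operator (morrey_norm 1 w1 psi1) (weak_morrey_norm 1 w2 psi2) S).
Proof.
have local NB := local_bound p s w1 w2 psi1 psi2 D S NB hp hs hs1 hw1 hw2 hw12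
  hw22 hpsi1 hpsi2 hpsi hD hDM hS hsize.
split=> [_ bS|p1].
  have [B g g1 T *|C C0 hC] := local (wLnorm p w2) _ bS; first exact: wLnorm_split.
  exists C => // f Xf; apply: ge_ereal_sup => _ [a _ [r r0 <-]]; exact: hC.
rewrite -p1 => bS.
have [B g g1 T *|C C0 hC] := local (wWLnorm p w2) _ bS; first exact: wWLnorm_split.
by exists C => // f Xf; apply: ge_ereal_sup => _ [a _ [r r0 <-]]; exact: hC.
Qed.
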